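(* Let $n$ and $k$ be integers with $n\geq 2k\geq 4$. Then $$\chi(\overline{K}(n,k))\leq h_o(\overline{K}(n,k)).$$ Moreover, there exists an integer $t=t(n,k)\geq \chi(\overline{K}(n,k))$ such that $\overline{K}(n,k)$ contains a strongly $1$-shallow $K_t$-minor. Furthermore, if $k\geq 3$, then $$h_o(\overline{K}(n,k))-\chi(\overline{K}(n,k))\geq \begin{cases}\frac{1}{12}\left(1.5^{k-1}-8k-2\right), & \text{if } 2k+1\leq n\leq 3k-2,\\[2pt] \frac{1}{6}\left(1.5^{k-1}-11\right), & \text{if } n=3k-1.\end{cases}$$
   Context: For integers $n\ge 2k\ge 4$, the Kneser graph $K(n,k)$ has as vertices the $k$-element subsets of $[n]=\{1,\dots,n\}$, two being adjacent iff they are disjoint; $\overline{K}(n,k)$ is its complement (two $k$-subsets adjacent iff they are distinct and intersect). $\chi$ denotes chromatic number. A signed graph $(G,\sigma)$ is a graph $G$ with a map $\sigma:E(G)\to\{+,-\}$. Switching at a vertex $x$ changes the sign of every edge incident with $x$; signed graphs obtained from each other by a sequence of switchings are switching equivalent. A signed graph $(H,\pi)$ is a minor of $(G,\sigma)$ if there exist a signature $\tau$ switching equivalent to $\sigma$ and pairwise vertex-disjoint subgraphs $B_x$ of $G$ ($x\in V(H)$) such that (i) for each $x$, the positive edges of $B_x$ under $\tau$ form a connected spanning subgraph of $B_x$, and (ii) for each edge $xy$ of $H$ there is an edge $uv$ of $G$ with $u\in V(B_x)$, $v\in V(B_y)$ and $\tau(uv)=\pi(xy)$. $(G,-)$ denotes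 $G$ with all edges negative. The odd Hadwiger number $h_o(G)$ is the largest $t$ such that $(K_t,-)$ is a minor of $(G,-)$. A $K_t$-minor of a graph $G$ is given by $t$ pairwise vertex-disjoint connected subgraphs (bags) of $G$, any two of which are joined by an edge of $G$. A star is $K_{1,s}$ for some $s\ge1$. A $K_t$-minor is strongly $1$-shallow if each bag is either a single vertex or a star, and for every two bags there is a connecting edge of $G$ each of whose endpoints is either the unique vertex of a single-vertex bag or a leaf vertex of a star bag. *)

(* Defs.v *)
From mathcomp Require Import all_boot all_algebra.
From Stdlib Require Import ClassicalEpsilon.

Unset Printing Implicit Defensive.

Definition pb (P : Prop) : bool :=
  if excluded_middle_informative P then true else false.

Definition colorable (T : finType) (e : rel T) (c : nat) : bool :=
  [exists f : {ffun T -> 'I_c},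
     [forall x, [forall y, e x y ==> (f x != f y)]]].

Arguments colorable {T}.

Lemma colorable_card (T : finType) (e : rel T) :
  irreflexive e -> colorable e #|T|.
Proof.
move=> Hirr; apply/existsP; exists [ffun x => enum_rank x].
apply/forallP=> x; apply/forallP=> y; apply/implyP=> Hxy; rewrite !ffunE.
apply/negP=> /eqP /enum_rank_inj Exy.
by rewrite Exy Hirr in Hxy.
Qed.

Arguments colorable_card {T e}.

Lemma ex_colorable (T : finType) (e : rel T) (H : irreflexive e) :
  exists c, colorable e c.
Proof. by exists #|T|; apply: colorable_card. Qed.

Arguments ex_colorable {T e}.

Definition chi (T : finType) (e : rel T) (H : irreflexive e) : nat :=
  ex_minn (ex_colorable H).
Arguments chi {T e}.

(* A signature assigns a sign to (the ordered pairs underlying) edges;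
   [true] stands for "+" and [false] for "-".  Only its values on edges
   matter. *)
Definition signature (T : finType) := T -> T -> bool.

Arguments signature : clear implicits.

Definition all_neg (T : finType) : signature T := fun _ _ => false.

Arguments all_neg {T}.

Definition switch (T : finType) (x : T) (s : signature T) : signature T :=
  fun u v => ((u == x) (+) (v == x)) (+) s u v.

Arguments switch {T}.

Definition switching_equiv (T : finType) (e : rel T) (s t : signature T) : Prop :=
  exists xs : seq T, forall u v, e u v -> t u v = foldr switch s xs u v.

Arguments switching_equiv {T}.

Definition connected_in (T : finType) (r : rel T) (A : {set T}) : Prop :=
  A != set0 /\
  {in A &, forall u v, connect [rel a b | [&& a \in A, b \in A & r a b]] u v}.

Arguments connected_in {T}.

(* (H, pi) is a minor of (G, sigma).  A bag B_x is represented by its vertex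
   set; condition (i) is then that the positive edges (under tau) of G inside
   the bag connect it. *)
Definition signed_minor (H : finType) (eH : rel H) (pi : signature H)
    (T : finType) (eG : rel T) (sigma : signature T) : Prop :=
  exists tau : signature T, switching_equiv eG sigma tau /\
  exists B : H -> {set T},
    [/\ (forall x y, x != y -> [disjoint B x & B y]),
        (forall x, connected_in [rel u v | eG u v && tau u v] (B x)) &
        (forall x y, eH x y ->
           exists u v, [/\ u \in B x, v \in B y, eG u v & tau u v = pi x y])].

Arguments signed_minor {H} eH pi {T}.

Definition complete (t : nat) : rel 'I_t := fun i j => i != j.

Definition has_odd_Kt_minor (T : finType) (e : rel T) (t : nat) : Prop :=
  signed_minor (@complete t) all_neg e all_neg.

Arguments has_odd_Kt_minor {T}.

(* odd Hadwiger number: largest t with (K_t,-) a minor of (G,-).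
   Any such t satisfies t <= #|T| (bags are disjoint and nonempty), so
   the maximum may be taken over t <= #|T|. *)
Definition odd_hadwiger (T : finType) (e : rel T) : nat :=
  \max_(t < #|T|.+1 | pb (has_odd_Kt_minor e t)) t.
Arguments odd_hadwiger {T}.

(* Bag i is given by a "centre" c i and a set of leaves L i.  If L i is
   empty, the bag is the single vertex c i; otherwise it is the star
   K_{1,|L i|} with centre c i and leaves L i.  The terminals of a bag
   (allowed endpoints of connecting edges) are its unique vertex, resp.
   its leaves. *)
Definition strongly_1_shallow_Kt_minor (T : finType) (e : rel T) (t : nat) : Prop :=
  exists (c : 'I_t -> T) (L : 'I_t -> {set T}),
    [/\ (forall i, c i \notin L i /\ forall l, l \in L i -> e (c i) l),
        (forall i j, i != j -> [disjoint c i |: L i & c j |: L j]) &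
        (forall i j, i != j -> exists u v,
           [/\ u \in (if L i == set0 then [set c i] else L i),
               v \in (if L j == set0 then [set c j] else L j) & e u v])].

Arguments strongly_1_shallow_Kt_minor {T}.

Definition kset (n k : nat) := {A : {set 'I_n} | #|A| == k}.

Definition Kbar (n k : nat) : rel (kset n k) :=
  fun A B => (A != B) && ~~ [disjoint val A & val B].

Lemma Kbar_irr (n k : nat) : irreflexive (Kbar n k).
Proof. by move=> A; rewrite /Kbar eqxx. Qed.

(* Main.v *)
Require Import Defs.
From Stdlib Require Import BinNat.
From mathcomp Require Import all_boot all_algebra zify ring lra.
Import GRing.Theory Num.Theory.

(**
Write n = kq + r with 0 <= r < k.  The k-sets of [n] split into
ceil(C(n,k) / q) families of pairwise disjoint sets (Baranyai), so chi is at
most this number, which exceeds C(n-1,k-1) only if r > 0.  All k-sets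
containing a fixed element z form a clique of size C(n-1,k-1).  A star of
k-sets avoiding z can be added to this clique as a further bag as soon as its
leaves together cover more than n - k elements, since then every k-set meets a
leaf.  It remains to find enough disjoint stars of this kind:
- q disjoint k-sets (a Baranyai class) as leaves, with a centre meeting all of
  them provided by Hall's theorem; a given k-set is missed by few k-sets when k
  is large compared with q;
- when q is large, sets x + C with x in {a, b} fixed and C in a Baranyai class
  of (k-1)-sets as leaves, so that a centre containing a or b meets almost all
  of them.
Finally, switching at the centres turns a strongly 1-shallow minor into an odd
minor.
*)

(** * Hall's theorem and integer rounding *)

Definition nbhd {A B : finType} (r : A -> B -> bool) (X : {set A}) : {set B} :=
  [set b | [exists a in X, r a b]].

Lemma nbhdU (A B : finType) (r : A -> B -> bool) (X Y : {set A}) :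
  nbhd r (X :|: Y) = nbhd r X :|: nbhd r Y.
Proof.
apply/setP=> b; rewrite !inE; apply/existsP/orP.
  case=> a /andP[]; rewrite inE => /orP[] aX rab; [left | right];
    by apply/existsP; exists a; rewrite aX.
by case=> /existsP[a /andP[aX rab]]; exists a; rewrite inE aX ?orbT.
Qed.

(** Halmos-Vaughan induction on the size of [D], where [E] is the part of [B] still free. If some
    nonempty proper [X] is tight, it is matched first and the rest avoids [nbhd r X]; if none is,
    any first choice is safe. [b0] serves as default value outside [D]. *)
Lemma hall_in (A B : finType) (b0 : B) (r : A -> B -> bool)
    (D : {set A}) (E : {set B}) :
  (forall X : {set A}, X \subset D -> #|X| <= #|nbhd r X :&: E|) ->
  exists f : A -> B,
    {in D &, injective f} /\ {in D, forall a, f a \in E /\ r a (f a)}.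
Proof.
have [n] := ubnP #|D|; elim: n D E => // n IH D E; rewrite ltnS => ltDn hD.
have [-> | /set0Pn[a0 a0D]] := eqVneq D set0.
  by exists (fun=> b0); split=> a; rewrite inE.
case: (boolP [exists X : {set A}, [&& X \proper D, X != set0 & #|nbhd r X :&: E| == #|X| ]]).
  case/existsP=> X /and3P[XD X0 /eqP tX].
  have [||f [fI fP]] := IH X E.
  - exact: leq_trans (proper_card XD) ltDn.
  - by move=> Y YX; apply: hD; apply: subset_trans YX (proper_sub XD).
  have [||g [gI gP]] := IH (D :\: X) (E :\: nbhd r X).
  - apply: leq_trans ltDn; apply: proper_card.
    rewrite properEneq subsetDl andbT; apply: contraNneq X0 => DX.
    apply/eqP/setP=> x; rewrite inE; apply/negP=> xX.
    by have := subsetP (proper_sub XD) _ xX; rewrite -DX inE xX.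
  (* Hall's condition for [X :|: Y], minus the tight count for [X], is the condition for [Y] after
     [nbhd r X] is removed. *)
  - move=> Y YD.
    have := hD (X :|: Y); rewrite subUset (proper_sub XD) (subset_trans YD (subsetDl _ _)).
    move=> /(_ isT); rewrite nbhdU cardsU.
    have -> : X :&: Y = set0.
      apply/setP=> x; rewrite !inE; apply/negP=> /andP[xX xY].
      by have := subsetP YD _ xY; rewrite inE xX.
    rewrite cards0 subn0 => h.
    have: #|(nbhd r X :|: nbhd r Y) :&: E| <= #|X| + #|nbhd r Y :&: (E :\: nbhd r X)|.
      rewrite -tX -cardsUI; apply: (leq_trans _ (leq_addr _ _)).
      apply: subset_leq_card; apply/subsetP=> x; rewrite !(in_setU, in_setI, in_setD).
      by case: (x \in nbhd r X); case: (x \in nbhd r Y); case: (x \in E).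
    by move=> h2; rewrite -(leq_add2l #|X|); apply: leq_trans h h2.
  exists (fun a => if a \in X then f a else g a); split.
    have key a : a \in D -> a \notin X -> g a \notin nbhd r X.
      by move=> aD aX; have [] := gP a; rewrite !in_setD ?aX // => /andP[].
    have key2 a : a \in X -> f a \in nbhd r X.
      by move=> aX; rewrite inE; apply/existsP; exists a; rewrite aX; case: (fP a aX).
    move=> a a' aD a'D; case: ifPn => aX; case: ifPn => a'X e.
    - exact: fI.
    - by move: (key _ a'D a'X); rewrite -e key2.
    - by move: (key _ aD aX); rewrite e key2.
    - by apply: gI => //; rewrite inE ?aX ?a'X.
  move=> a aD; case: ifPn => aX; first exact: fP.
  by have [] := gP a; rewrite !in_setD ?aX // => /andP[].
(* Now every nonempty proper subset of [D] has a spare neighbour, so [b] can be spent on [a0]. *)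
move/existsPn=> nt.
have: 0 < #|nbhd r [set a0] :&: E|.
  by apply: leq_trans (hD _ _); rewrite ?cards1 ?sub1set.
case/card_gt0P=> b; rewrite !inE => /andP[/existsP[a /andP[]]].
rewrite inE => /eqP-> rab bE.
have [||f [fI fP]] := IH (D :\ a0) (E :\ b).
- by move: ltDn; rewrite (cardsD1 a0 D) a0D.
- move=> Y YD; have [-> | Y0] := eqVneq Y set0; first by rewrite cards0.
  have YsD : Y \subset D by apply: subset_trans YD (subsetDl _ _).
  have pY : Y \proper D.
    rewrite properEneq YsD andbT; apply: contraTneq a0D => <-.
    by apply/negP=> /(subsetP YD); rewrite !inE eqxx.
  have := nt Y; rewrite pY Y0 /= => neY.
  have lt : #|Y| < #|nbhd r Y :&: E| by rewrite ltn_neqAle eq_sym neY hD.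
  rewrite -ltnS; apply: leq_trans lt _.
  rewrite (cardsD1 b (nbhd r Y :&: E)) -add1n leq_add ?leq_b1 //.
  by rewrite setIDA.
exists (fun a => if a == a0 then b else f a); split.
  move=> a1 a2 a1D a2D; case: eqVneq => [->|n1]; case: eqVneq => [->|n2] // e.
  - by have [] := fP a2; rewrite !inE ?n2 // -e eqxx.
  - by have [] := fP a1; rewrite !inE ?n1 // e eqxx.
  - by apply: fI; rewrite // !inE ?n1 ?n2.
move=> a1 a1D; case: eqVneq => [->|n1] //.
by have [] := fP a1; rewrite !inE ?n1 // => /andP[].
Qed.

Lemma hall (A B : finType) (r : A -> B -> bool) :
  (forall X : {set A}, #|X| <= #|nbhd r X|) ->
  exists f : A -> B, injective f /\ forall a, r a (f a).
Proof.
(* If [A] is empty, [B] may be empty as well, and there is no default [b0] to pass on. *)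
move=> hA; case: (pickP {: A}) => [a _ | A0]; last first.
  by exists (fun a => False_rect B (notF (esym (A0 a)))); split=> a; have := A0 a.
have: 0 < #|nbhd r [set a]| by apply: leq_trans (hA _); rewrite cards1.
case/card_gt0P=> b0 _.
have [X _ |f [fI fP]] := @hall_in A B b0 r setT setT; first by rewrite setIT.
by exists f; split=> [x y /fI-> //|x]; case: (fP x).
Qed.

Lemma sum_fibers {T I : finType} (f : T -> I) (w : T -> nat) (N : pred I) :
  \sum_(i | N i) \sum_(t | f t == i) w t = \sum_(t | N (f t)) w t.
Proof.
rewrite [RHS](partition_big f N) //=; apply: eq_bigr => i iN.
by apply: eq_bigl => t; case: eqP => [->|]; rewrite ?iN ?andbF.
Qed.

(* Hall's condition holds for i |-> {slots (j, s), s < d j} because w / L is a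
   perfect fractional matching between I and the slots. *)
Lemma round_tight {T I J : finType} (f : T -> I) (g : T -> J) (w : T -> nat)
    (L : nat) (d : J -> nat) :
  0 < L ->
  (forall i, \sum_(t | f t == i) w t = L) ->
  (forall j, \sum_(t | g t == j) w t = L * d j) ->
  exists h : I -> T, (forall i, f (h i) = i /\ 0 < w (h i)) /\
    forall j, #|[set i | g (h i) == j]| = d j.
Proof.
move=> L0 hf hg.
pose slot := {j : J & 'I_(d j)}.
pose r i (s : slot) := [exists t, [&& f t == i, g t == tag s & 0 < w t]].
have card_slots (N : {set J}) : #|[set s : slot | tag s \in N]| = \sum_(j in N) d j.
  rewrite -sum1_card (eq_bigl (fun s : slot => (tag s \in N) && true)); last first.
    by move=> s; rewrite inE andbT.
  rewrite -(sig_big_dep (J := fun j => 'I_(d j)) (fun j => j \in N) (fun _ _ => true) (fun _ _ => 1)) /=.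
  by apply: eq_bigr => j _; rewrite sum1_card card_ord.
have [|phi [phiI phiP]] := @hall I slot r.
  move=> X; pose N := [set j | [exists t, [&& f t \in X, g t == j & 0 < w t]]].
  have -> : nbhd r X = [set s | tag s \in N].
    apply/setP=> s; rewrite !inE; apply/existsP/existsP.
      by case=> i /andP[iX /existsP[t /and3P[/eqP ft gt wt]]]; exists t; rewrite ft iX gt.
    case=> t /and3P[ft gt wt]; exists (f t); rewrite ft; apply/existsP; exists t.
    by rewrite eqxx gt.
  rewrite card_slots -(leq_pmul2l L0) big_distrr /=.
  rewrite -(eq_bigr _ (fun j _ => hg j)) mulnC -sum_nat_const -(eq_bigr _ (fun i _ => hf i)).
  rewrite !sum_fibers big_mkcond [X in _ <= X]big_mkcond /=; apply: leq_sum => t _.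
  case: ifP => // ftX; case: ifP => // /negbT; rewrite inE => /existsPn/(_ t).
  by rewrite ftX eqxx /= -eqn0Ngt => /eqP->.
(* Summing [w] by rows and by columns gives as many slots as rows, so the injection [phi] is onto
   and each [j] is used exactly [d j] times. *)
have cI : #|{: slot}| = #|I|.
  have -> : #|{: slot}| = \sum_(j in [set: J]) d j.
    by rewrite -card_slots -cardsT; apply: eq_card => s; rewrite !inE.
  apply/eqP; rewrite -(eqn_pmul2l L0) big_distrr /=.
  rewrite -(eq_bigr _ (fun j _ => hg j)) mulnC -sum_nat_const -(eq_bigr _ (fun i _ => hf i)).
  rewrite !sum_fibers (eq_bigl predT) ?[X in _ == X](eq_bigl predT) // => t; by rewrite inE.
have phiB : bijective phi by apply: inj_card_bij => //; rewrite cI.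
have [h hP] : exists h : I -> T, forall i,
    [&& f (h i) == i, g (h i) == tag (phi i) & 0 < w (h i)].
  by apply: (@fin_all_exists I (fun=> T) (fun i t => [&& f t == i, g t == tag (phi i) & 0 < w t])) => i;
    apply/existsP; apply: phiP.
exists h; split=> [i|j]; first by case/and3P: (hP i) => /eqP.
rewrite -[RHS](big_set1 addn j d) -card_slots.
rewrite -(on_card_preimset (f := phi)); last by apply: onW_bij.
by apply: eq_card => i; rewrite !inE; case/and3P: (hP i) => _ /eqP->.
Qed.

(** Reduction to the tight case: each row [i] receives a dummy entry carrying its slack, and all
    dummies share an extra column [None]. Rows that choose their dummy contribute nothing to [Y]; a
    row without slack has a dummy of weight 0 and must choose a real entry. *)
Lemma round {T I J : finType} (f : T -> I) (g : T -> J) (w : T -> nat)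
    (L : nat) (d : J -> nat) :
  0 < L ->
  (forall i, \sum_(t | f t == i) w t <= L) ->
  (forall j, \sum_(t | g t == j) w t = L * d j) ->
  exists Y : {set T}, [/\ {in Y, forall t, 0 < w t}, {in Y &, injective f},
    (forall i, \sum_(t | f t == i) w t = L -> exists2 t, t \in Y & f t = i) &
    (forall j, #|[set t in Y | g t == j]| = d j)].
Proof.
move=> L0 hf hg.
pose f' (t : T + I) := match t with inl t => f t | inr i => i end.
pose g' (t : T + I) := match t with inl t => Some (g t) | inr i => None end.
pose w' (t : T + I) :=
  match t with inl t => w t | inr i => L - \sum_(t | f t == i) w t end.
pose d' (j : option J) := match j with Some j => d j | None => #|I| - \sum_j d j end.
have [i|[j|]|h [hf' hg']] := @round_tight (T + I)%type I (option J) f' g' w' L d' L0.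
- by rewrite big_sumType /= big_pred1_eq subnKC.
- by rewrite big_sumType /= [X in _ + X]big_pred0 // addn0; apply: hg.
- rewrite big_sumType /= [X in X + _]big_pred0 // add0n mulnBr (eq_bigl xpredT) // sumnB // sum_nat_const mulnC.
  congr (_ - _); rewrite sum_fibers big_distrr /=.
  by rewrite -(eq_bigr _ (fun j _ => hg j)) sum_fibers.
have Yf t : h (f t) = inl t -> 0 < w t by have [_] := hf' (f t); case: (h (f t)) => // t' ? [<-].
exists [set t | h (f t) == inl t]; split.
- by move=> t; rewrite inE => /eqP /Yf.
- move=> t u; rewrite !inE => /eqP ht /eqP hu e; move: ht; rewrite e hu.
  by case.
- move=> i hi; have [] := hf' i; case E: (h i) => [t|j] /=.
    by move=> fti _; exists t; rewrite ?inE ?fti ?E.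
  by move=> ->; rewrite hi subnn.
- move=> j; rewrite -[RHS](hg' (Some j)) -(card_in_imset (f := f)); last first.
    move=> t u; rewrite !inE => /andP[/eqP ht _] /andP[/eqP hu _] e; move: ht.
    by rewrite e hu; case.
  apply: eq_card => i; rewrite inE; apply/imsetP/eqP.
    by case=> t; rewrite !inE => /andP[/eqP ht /eqP<-] ->; rewrite ht.
  case E: (h i) => [t|//] /= [gt]; have [] := hf' i; rewrite E /= => ft _.
  by exists t => //; rewrite !inE ft E gt !eqxx.
Qed.

(** * Baranyai's theorem *)

Lemma card_div_fiber (C q i : nat) : 0 < q ->
  #|[set t : 'I_C | t %/ q == i]| = minn q (C - q * i).
Proof.
move=> q0; rewrite -sum1_card (eq_bigl (fun t : 'I_C => t %/ q == i)); last first.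
  by move=> t; rewrite inE.
rewrite big_mkcond /=; elim: C => [|C IH]; first by rewrite big_ord0 sub0n minn0.
rewrite big_ord_recr /= {}IH.
have -> : (C %/ q == i) = (i * q <= C) && (C < i.+1 * q).
  by rewrite eqn_leq -ltnS ltn_divLR // leq_divRL // andbC.
by case: ifP; nia.
Qed.

(* The elements t of T are the k-sets under construction, grouped in classes by
   cls; S t is the part of t inside the set R of elements of G treated so far.
   A new element of G goes to t with fractional weight
   (k - #|S t|) / (#|G| - #|R|), and rounding makes this choice integral. *)
Definition baranyai_state {V : finType} (G R : {set V}) (k : nat) {T I : finType}
    (cls : T -> I) (S : T -> {set V}) : Prop :=
  [/\ forall t, S t \subset R /\ #|S t| <= k,
      forall t u, t != u -> cls t = cls u -> [disjoint S t & S u],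
      forall A : {set V}, A \subset R -> #|A| <= k ->
        #|[set t | S t == A]| = 'C(#|G| - #|R|, k - #|A|) &
      forall i, \sum_(t | cls t == i) (k - #|S t|) <= #|G| - #|R|].

(** Rounding yields the set [Y] of those [t] that receive [x]: at most one per class, which keeps
    classes disjoint; one from each class whose deficit fills the bound, which keeps deficits within
    the remaining elements; and the right number for each partial set. *)
Lemma baranyai_step {V : finType} {G R : {set V}} {k : nat} {T I : finType}
    {cls : T -> I} {S : T -> {set V}} {x : V} :
  R \subset G -> x \in G -> x \notin R -> baranyai_state G R k cls S ->
  exists S', baranyai_state G (x |: R) k cls S'.
Proof.
move=> RG xG xR [Sb Sd Sc Sw].
have RltG : #|R| < #|G|.
  by apply: proper_card; apply/properP; split=> //; exists x.
pose L := #|G| - #|R|; have L0 : 0 < L by rewrite subn_gt0.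
have LE : #|G| - #|x |: R| = L.-1 by rewrite cardsU1 xR /L; lia.
(* Of the ['C(L, k - #|A|)] copies of [A], [d A] receive [x]; the absorption identity makes the
   column sum equal to [L * d A]. *)
pose d (A : {set V}) := if (A \subset R) && (#|A| < k) then 'C(L.-1, (k - #|A|).-1) else 0.
have [|A|Y [Yw YI Yt Yc]] := round cls S (fun t => k - #|S t|) L d L0.
- exact: Sw.
- rewrite (eq_bigr (fun=> k - #|A|)); last by move=> t /eqP->.
  rewrite sum_nat_cond_const /d; case: ifP => [/andP[AR Ak]|nA].
    rewrite -(eq_card (A := [set t | S t == A])); last by move=> t; rewrite !inE.
    rewrite Sc // 1?ltnW // -/L.
    have -> : k - #|A| = (k - #|A|).-1.+1 by rewrite prednK // subn_gt0.
    by rewrite mul_bin_diag mulnC.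
  rewrite muln0; apply/eqP; rewrite muln_eq0.
  case: (posnP (k - #|A|)) => [_|kA]; first by rewrite orbT.
  rewrite orbF; apply/eqP/eq_card0 => t; rewrite !inE; apply/negP=> /eqP e.
  by move: nA; rewrite -subn_gt0 kA andbT -e; case: (Sb t) => ->.
pose S' t := if t \in Y then x |: S t else S t.
have xS t : x \notin S t by apply: contra xR; apply/subsetP; case: (Sb t).
exists S'; split.
- move=> t; rewrite /S'; case: ifP => tY; have [h1 h2] := Sb t.
    by rewrite setUS // cardsU1 xS add1n -subn_gt0 (Yw t tY).
  by split=> //; apply: subset_trans h1 (subsetUr _ _).
- move=> t u ne e; rewrite /S'; have dd := Sd _ _ ne e.
  have xd (s : T) (B : {set V}) : x \notin B -> [disjoint S s & B] -> [disjoint x |: S s & B].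
    by move=> xB h; rewrite -setI_eq0 setIUl setU_eq0 !setI_eq0 h disjoints1 xB.
  case: ifP => tY; case: ifP => uY //.
  - by rewrite (YI _ _ tY uY e) eqxx in ne.
  - exact: xd.
  - by rewrite disjoint_sym; apply: xd => //; rewrite disjoint_sym.
(* Copies of a set containing [x] come from the [t] in [Y]; the copies of [A] that stay as they are
   get counted by Pascal's rule. *)
- move=> A AR Ak; rewrite LE; have [xA|xA] := boolP (x \in A).
    have AxR : A :\ x \subset R by rewrite subDset.
    have cA : #|A| = #|A :\ x|.+1 by rewrite (cardsD1 x A) xA.
    have -> : k - #|A| = (k - #|A :\ x|).-1 by rewrite cA; lia.
    have := Yc (A :\ x); rewrite /d AxR -cA Ak /= => <-.
    apply: eq_card => t; rewrite !inE /S'; case: ifP => tY.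
      apply/eqP/eqP=> [<-|->]; last by rewrite setD1K.
      by rewrite setU1K.
    by apply/eqP=> e; have := xS t; rewrite e xA.
  have AR' : A \subset R.
    by apply/subsetP=> y yA; have := subsetP AR y yA; rewrite !inE;
       case/orP=> // /eqP e; rewrite -e yA in xA.
  have E : #|[set t | S t == A]| = d A + #|[set t | S' t == A]|.
    rewrite -Yc -(cardsID Y [set t | S t == A]); congr (_ + _); apply: eq_card => t.
      by rewrite !inE andbC.
    rewrite !inE /S'; case: ifP => tY //=.
    by apply/esym/eqP=> e; rewrite -e !inE eqxx in xA.
  move: E; rewrite Sc // -/L /d AR' /=; case: ltnP => kA.
    have -> : k - #|A| = (k - #|A|).-1.+1 by rewrite prednK // subn_gt0.
    rewrite -[in 'C(L, _)](prednK L0) binS /= addnC => /addnI <-.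
    by rewrite prednK // subn_gt0.
  have -> : k - #|A| = 0 by apply/eqP; rewrite subn_eq0.
  by rewrite !bin0.
- move=> i; rewrite LE.
  have le t : k - #|S' t| <= k - #|S t|.
    rewrite /S' leq_sub2l //; case: ifP => // _.
    by apply: subset_leq_card; apply: subsetUr.
  have := Sw i; rewrite -/L leq_eqVlt => /orP[/eqP tight|]; last first.
    move=> h; rewrite -ltnS prednK //; apply: leq_ltn_trans h.
    by apply: leq_sum.
  have [t tY ti] := Yt i tight.
  rewrite -ltnS prednK // -tight (bigD1 t) ?ti //= [X in _ < X](bigD1 t) ?ti //=.
  rewrite -addSn leq_add //; last by apply: leq_sum.
  by rewrite /S' tY cardsU1 xS add1n; have := Yw t tY; lia.
Qed.

(** The process starts from ['C(#|G|, k)] empty sets in consecutive classes of [q], the last one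
    possibly shorter; [k * q <= #|G|] is the initial deficit bound. Once all of [G] is treated, the
    multiplicities are ['C(0, k - #|A|)], so each k-set occurs exactly once. *)
Lemma baranyai {V : finType} (G : {set V}) (k q : nat) :
  0 < q -> k * q <= #|G| ->
  exists f : {set V} -> nat,
    (forall A B : {set V}, A \subset G -> B \subset G -> #|A| = k -> #|B| = k ->
       f A = f B -> A != B -> [disjoint A & B]) /\
    (forall i, #|[set A : {set V} | [&& A \subset G, #|A| == k & f A == i]]|
                 = minn q ('C(#|G|, k) - q * i)).
Proof.
move=> q0 kq; pose C := 'C(#|G|, k).
pose cls (t : 'I_C) : 'I_C := Ordinal (leq_ltn_trans (leq_div t q) (ltn_ord t)).
have st l : l <= #|G| -> exists (R : {set V}) (S : 'I_C -> {set V}),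
    [/\ R \subset G, #|R| = l & baranyai_state G R k cls S].
  elim: l => [_|l IH lG].
    exists set0, (fun=> set0); split; rewrite ?sub0set ?cards0 //.
    split=> [t|t u _ _|A|i]; rewrite ?cards0 ?sub0set ?subn0 //.
    - by rewrite -setI_eq0 setI0.
    - rewrite subset0 => /eqP-> _; rewrite cards0 subn0 -[RHS]card_ord.
      by apply: eq_card => t; rewrite !inE eqxx.
    rewrite sum_nat_cond_const; apply: leq_trans kq; rewrite mulnC leq_mul2l.
    apply/orP; right; rewrite (_ : #|_| = #|[set t : 'I_C | t %/ q == i]|); last first.
      by apply: eq_card => t; rewrite !inE -val_eqE.
    by rewrite card_div_fiber // geq_minl.
  have [R [S [RG Rl RS]]] := IH (ltnW lG).
  have [x xG xR] : exists2 x, x \in G & x \notin R.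
    by apply/subsetPn/negP=> /subset_leq_card; rewrite Rl leqNgt lG.
  have [S' S'P] := baranyai_step RG xG xR RS.
  exists (x |: R), S'; split=> //; first by rewrite subUset sub1set xG.
  by rewrite cardsU1 xR Rl.
have [R [S [RG Rl [Sb Sd Sc _]]]] := st #|G| (leqnn _).
have ER : R = G by apply/eqP; rewrite eqEcard RG Rl leqnn.
subst R; rewrite subnn in Sc.
(* [t] itself is among the copies of [S t], so the multiplicity ['C(0, k - #|S t|)] is nonzero. *)
have Sk t : #|S t| = k.
  have [h1 h2] := Sb t; have := Sc _ h1 h2.
  rewrite bin0n; case: (posnP (k - #|S t|)) => [e _|kS /eqP]; first by lia.
  rewrite cards_eq0 => /eqP/setP/(_ t).
  by rewrite !inE eqxx.
have Scard (A : {set V}) : A \subset G -> #|A| = k -> #|[set t | S t == A]| = 1.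
  by move=> AG Ak; rewrite Sc ?Ak // subnn.
have SI : injective S.
  move=> t u e; have := Scard (S u) (proj1 (Sb u)) (Sk u).
  move/eqP/cards1P=> [v /setP hv]; have := hv t; have := hv u.
  by rewrite !inE e eqxx => /esym/eqP-> /esym/eqP.
have Ssur (A : {set V}) : A \subset G -> #|A| = k -> exists t, S t = A.
  move=> AG Ak; have /eqP/cards1P[t /setP/(_ t)] := Scard A AG Ak.
  by rewrite !inE eqxx => /eqP; exists t.
pose f A := if [pick t | S t == A] is Some t then nat_of_ord (cls t) else 0.
have fS t : f (S t) = cls t.
  by rewrite /f; case: pickP => [u /eqP/SI->|/(_ t)] //; rewrite eqxx.
exists f; split.
  move=> A B AG BG Ak Bk; have [t <-] := Ssur A AG Ak; have [u <-] := Ssur B BG Bk.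
  rewrite !fS => e ne; apply: Sd; last exact: val_inj.
  by apply: contraNneq ne => ->.
move=> i; rewrite -card_div_fiber // -(card_imset _ SI); apply: eq_card => A.
rewrite inE; apply/and3P/imsetP.
  case=> AG /eqP Ak; have [t <-] := Ssur A AG Ak; rewrite fS => h.
  by exists t; rewrite ?inE.
by case=> t; rewrite inE => h ->; rewrite fS Sk; case: (Sb t).
Qed.

(** * Colourings and shallow minors of the complement of the Kneser graph *)

(** Baranyai classes are independent in [Kbar], and when [q * c] reaches ['C(n, k)] those with index
    at least [c] are empty. *)
Lemma chi_Kbar_le (n k q c : nat) :
  0 < q -> k * q <= n -> 'C(n, k) <= q * c -> chi (Kbar_irr n k) <= c.
Proof.
move=> q0 kq Cc; have [] := @baranyai 'I_n setT k q q0.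
  by rewrite cardsT card_ord.
move=> f [fd fc].
have fk (A : kset n k) : f (val A) < c.
  have : 0 < minn q ('C(n, k) - q * f (val A)).
    rewrite -[X in 'C(X, _)](card_ord n) -cardsT -fc; apply/card_gt0P; exists (val A).
    by rewrite inE subsetT (valP A) eqxx.
  rewrite leq_min subn_gt0 => /andP[_ h].
  by rewrite -(ltn_pmul2l q0); apply: leq_trans h Cc.
rewrite /chi; case: ex_minnP => m _; apply; apply/existsP.
exists [ffun A => Ordinal (fk A)]; apply/forallP=> A; apply/forallP=> B.
apply/implyP=> /andP[AB]; apply: contra; rewrite !ffunE => /eqP[e].
by apply: fd; rewrite ?subsetT //; [apply/eqP/(valP A) | apply/eqP/(valP B)].
Qed.

Lemma foldr_switch (T : finType) (s : signature T) (xs : seq T) (u v : T) :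
  foldr switch s xs u v = odd (count_mem u xs) (+) odd (count_mem v xs) (+) s u v.
Proof.
elim: xs => //= x xs IH; rewrite /switch {}IH !oddD !oddb (eq_sym u) (eq_sym v).
case: (x == u); case: (x == v); case: (odd (count_mem u xs));
  by case: (odd (count_mem v xs)); case: (s u v).
Qed.

Lemma pbT (P : Prop) : P -> pb P.
Proof. by rewrite /pb; case: ClassicalEpsilon.excluded_middle_informative. Qed.

(** Switching happens at the set [X] of centres of the bags that have leaves. Edges from centre to
    leaf have one end in [X] and become positive; connecting edges have no end in [X] and stay
    negative. *)
Lemma odd_minor_of_shallow (T : finType) (e : rel T) (t : nat) :
  symmetric e -> strongly_1_shallow_Kt_minor e t -> has_odd_Kt_minor e t.
Proof.
move=> esym [c [L [cL dcL tcL]]].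
pose X := [set c i | i in [pred i | L i != set0]].
have tauE u v : foldr switch all_neg (enum X) u v = (u \in X) (+) (v \in X).
  by rewrite foldr_switch !count_uniq_mem ?enum_uniq // !mem_enum !oddb addbF.
have dj i j x : x \in c i |: L i -> x \in c j |: L j -> i = j.
  move=> xi xj; apply/eqP/negP=> /negP /dcL; rewrite -setI_eq0 => /eqP/setP/(_ x).
  by rewrite !inE in xi xj *; rewrite xi xj.
(* A terminal equal to some centre in [X] would, by disjointness, lie in that centre's own bag,
   hence among its leaves. *)
have termX i u : u \in (if L i == set0 then [set c i] else L i) -> u \notin X.
  move=> ui; apply/imsetP=> -[j]; rewrite inE => Lj uc.
  have E : i = j.
    apply: (dj _ _ u); last by rewrite uc !inE eqxx.
    by case: ifP ui => _; rewrite !inE => ->; rewrite ?orbT.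
  move: ui; rewrite E (negPf Lj) uc => h.
  by have [] := cL j; rewrite h.
exists (foldr switch all_neg (enum X)); split; first by exists (enum X).
exists (fun i => c i |: L i); split.
- exact: dcL.
- move=> i; split; first by apply/set0Pn; exists (c i); rewrite !inE eqxx.
  pose r := [rel a b | [&& a \in c i |: L i, b \in c i |: L i
               & [rel u v | e u v && foldr switch all_neg (enum X) u v] a b]].
  have pos l : l \in L i -> (c i \in X) && (l \notin X).
    move=> li; have L0 : L i != set0 by apply/set0Pn; exists l.
    by rewrite imset_f //= (termX i) // (negPf L0).
  have cl l : l \in L i -> r (c i) l && r l (c i).
    move=> li; have /andP[h1 h2] := pos l li.
    rewrite /= !tauE h1 (negPf h2) /= esym !inE eqxx li orbT /=.
    by have [_ /(_ l li)] := cL i; rewrite esym => ->.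
  have toc u : u \in c i |: L i -> connect r u (c i) && connect r (c i) u.
    rewrite !inE => /orP[/eqP->|li]; first by rewrite !connect0.
    by have /andP[h1 h2] := cl u li; rewrite !connect1.
  move=> u v /toc/andP[h1 _] /toc/andP[_ h2]; exact: connect_trans h1 h2.
- move=> i j /tcL[u [v [ui vj euv]]]; exists u, v.
  have tT k w : w \in (if L k == set0 then [set c k] else L k) -> w \in c k |: L k.
    by case: ifP => _; rewrite !inE => ->; rewrite ?orbT.
  by split; rewrite ?tT // tauE (negPf (termX _ _ ui)) (negPf (termX _ _ vj)).
Qed.

Lemma leq_odd_hadwiger (T : finType) (e : rel T) (t : nat) :
  symmetric e -> strongly_1_shallow_Kt_minor e t -> t <= odd_hadwiger e.
Proof.
move=> esym h.
(* Centres are distinct, so [t] lies in the range of the maximum defining [odd_hadwiger]. *)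
have tT : t < #|T|.+1.
  have [c [L [_ dcL _]]] := h; rewrite ltnS -[t]card_ord; apply: (@leq_card _ _ c).
  move=> i j eij; apply/eqP/negP=> /negP /dcL; rewrite -setI_eq0 => /eqP/setP/(_ (c i)).
  by rewrite !inE eij eqxx.
rewrite /odd_hadwiger.
apply: (leq_bigmax_cond (P := fun t : 'I_#|T|.+1 => pb (has_odd_Kt_minor e t))
  (F := @nat_of_ord _) (Ordinal tT)).
by apply/pbT/odd_minor_of_shallow.
Qed.

Lemma shallow_of_finType {T I : finType} (e : rel T) (c : I -> T) (L : I -> {set T}) :
  (forall i, c i \notin L i /\ forall l, l \in L i -> e (c i) l) ->
  (forall i j, i != j -> [disjoint c i |: L i & c j |: L j]) ->
  (forall i j, i != j -> exists u v,
     [/\ u \in (if L i == set0 then [set c i] else L i),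
         v \in (if L j == set0 then [set c j] else L j) & e u v]) ->
  strongly_1_shallow_Kt_minor e #|I|.
Proof.
move=> h1 h2 h3; exists (c \o enum_val), (L \o enum_val).
split=> [i|i j ij|i j ij] //=; [apply: h2 | apply: h3];
  by rewrite (inj_eq enum_val_inj).
Qed.

Lemma card_draws_avoiding (T : finType) (Z : {set T}) (k : nat) :
  #|[set A : {set T} | [disjoint Z & A] && (#|A| == k)]| = 'C(#|T| - #|Z|, k).
Proof.
have -> : #|T| - #|Z| = #|~: Z| by rewrite -(cardsC Z) addKn.
by rewrite -cards_draws; apply: eq_card => A; rewrite !inE disjoint_sym disjoints_subset.
Qed.

Lemma card_draws_containing (T : finType) (z : T) (k : nat) : 0 < k ->
  #|[set A : {set T} | (z \in A) && (#|A| == k)]| = 'C(#|T|.-1, k.-1).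
Proof.
case: k => // k _; apply/eqP; rewrite -(eqn_add2l 'C(#|T|.-1, k.+1)) /= -binS.
have T0 : 0 < #|T| by apply/card_gt0P; exists z.
rewrite prednK // -card_draws addnC -(cardsID [set A : {set T} | z \in A] [set A : {set T} | #|A| == k.+1]).
apply/eqP; congr (_ + _).
  by apply: eq_card => A; rewrite !inE andbC.
rewrite -subn1 -(cards1 z) -card_draws_avoiding; apply: eq_card => A.
by rewrite !inE disjoints1.
Qed.

(* Star bags avoiding z, to be added to the clique of all k-sets containing z;
   the third condition makes every k-set meet a leaf of each star. *)
Definition bag_family {n : nat} (k : nat) (z : 'I_n) {I : finType}
    (c : I -> {set 'I_n}) (L : I -> {set {set 'I_n}}) : Prop :=
  [/\ forall i, [/\ #|c i| = k, z \notin c i & c i \notin L i],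
      forall i A, A \in L i -> [/\ #|A| = k, z \notin A & ~~ [disjoint c i & A]],
      forall i, n - k < #|cover (L i)| &
      forall i j, i != j -> [disjoint c i |: L i & c j |: L j]].

Lemma Kbar_sym (n k : nat) : symmetric (Kbar n k).
Proof. by move=> A B; rewrite /Kbar eq_sym disjoint_sym. Qed.

Lemma shallow_of_bags {n k : nat} {z : 'I_n} {I : finType}
    {c : I -> {set 'I_n}} {L : I -> {set {set 'I_n}}} :
  0 < k -> bag_family k z c L ->
  strongly_1_shallow_Kt_minor (Kbar n k) ('C(n.-1, k.-1) + #|I|).
Proof.
move=> k0 [cP LP Lcov Ld].
pose sing := {A : kset n k | z \in val A}.
have cardS : #|{: sing}| = 'C(n.-1, k.-1).
  rewrite card_sig -[n in 'C(n.-1, _)]card_ord -(@card_draws_containing _ z) //.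
  rewrite -(card_imset _ val_inj); apply: eq_card => A; rewrite inE.
  apply/imsetP/andP => [[B zB ->]|[zA kA]]; first by rewrite (valP B).
  by exists (Sub A kA : kset n k) => //; rewrite SubK.
have singI (A B : sing) : val A = val B -> A = B by exact: val_inj.
have ck i : #|c i| == k by case: (cP i) => ->.
pose c' (i : sing + I) : kset n k :=
  match i with inl A => val A | inr i => Sub (c i) (ck i) end.
pose L' (i : sing + I) : {set kset n k} :=
  match i with inl A => set0 | inr i => [set B | val B \in L i] end.
(* A k-set disjoint from [cover (L i)] would give more than [k + (n - k)] elements. *)
have meet i (A : {set 'I_n}) : #|A| = k -> exists2 B, B \in L i & ~~ [disjoint A & B].
  move=> kA; have: ~~ [disjoint A & cover (L i)].
    apply/negP=> d; have := Lcov i.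
    have : #|A :|: cover (L i)| <= n by rewrite -[n in _ <= n]card_ord max_card.
    by rewrite cardsU (eqP (_ : A :&: _ == set0)) ?setI_eq0 // cards0 kA; lia.
  rewrite -setI_eq0 => /set0Pn[x]; rewrite inE => /andP[xA /bigcupP[B BL xB]].
  by exists B => //; rewrite -setI_eq0; apply/set0Pn; exists x; rewrite inE xA.
have ksetOf i B : B \in L i -> exists2 B' : kset n k, val B' = B & B' \in L' (inr i).
  move=> BL; have [/eqP kB _ _] := LP i B BL.
  by exists (Sub B kB); rewrite ?inE SubK.
have L'0 i : (L' (inr i) == set0) = false.
  have [B BL _] := meet i (c i) (eqP (ck i)).
  by have [B' _ B'L] := ksetOf i B BL; apply/negbTE/set0Pn; exists B'.
have meet' i (A : kset n k) : exists2 B : kset n k, B \in L' (inr i) & ~~ [disjoint val A & val B].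
  have [B BL dB] := meet i (val A) (eqP (valP A)).
  by have [B' E B'L] := ksetOf i B BL; exists B'; rewrite ?E.
have zbag i (B : kset n k) : B \in c' (inr i) |: L' (inr i) -> z \notin val B.
  rewrite !inE => /orP[/eqP->|/LP[] //]; by case: (cP i).
rewrite -cardS -card_sum; apply: (@shallow_of_finType _ _ _ c' L').
- case=> [A|i] /=; first by split=> [|l]; rewrite inE.
  have [_ _ h] := cP i; split; first by rewrite inE SubK.
  move=> B; rewrite inE => BL; rewrite /Kbar SubK.
  have [_ _ ->] := LP i _ BL; rewrite andbT -val_eqE SubK.
  by apply: contraNneq h => ->.
- have sb A i : [disjoint c' (inl A) |: L' (inl A) & c' (inr i) |: L' (inr i)].
    rewrite /= setU0 disjoints1; apply/negP=> /zbag; by rewrite (valP A).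
  case=> [A|i] [B|j] ij.
  - by rewrite /= !setU0 disjoints1 inE; apply: contraNneq ij => /singI ->.
  - exact: sb.
  - rewrite disjoint_sym; exact: sb.
  - rewrite -setI_eq0; apply/eqP/setP=> B; rewrite !inE /= -!val_eqE !SubK.
    apply/negbTE/negP=> /andP[h1 h2].
    have := Ld i j ij; rewrite -setI_eq0 => /eqP/setP/(_ (val B)).
    by rewrite !inE h1 h2.
- have sb (A : sing) i : exists u v,
      [/\ u \in [set val A], v \in L' (inr i) & Kbar n k u v].
    have [B BL dB] := meet' i (val A); exists (val A), B.
    split; [by rewrite inE | by [] |]; rewrite /Kbar dB andbT.
    have : z \notin val B by apply: (zbag i); rewrite in_setU BL orbT.
    by apply: contraNneq => <-; apply: valP A.
  case=> [A|i] [B|j] ij.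
  - exists (val A), (val B); rewrite /= eqxx !inE; split=> //.
    have -> : Kbar n k (val A) (val B) = ~~ [disjoint val (val A) & val (val B)].
      by rewrite /Kbar (_ : val A != val B) //; apply: contraNneq ij => /singI ->.
    rewrite -setI_eq0; apply/set0Pn; exists z.
    by rewrite inE (valP A) (valP B).
  - have [u [v [h1 h2 h3]]] := sb A j.
    by exists u, v; rewrite L'0; split=> //; rewrite /= eqxx.
  - have [u [v [h1 h2 h3]]] := sb B i.
    by exists v, u; rewrite L'0; split=> //; [rewrite /= eqxx | rewrite Kbar_sym].
  (* For two stars, any leaf of the first meets some leaf of the second; the two leaves differ
     because the bags are disjoint. *)
  - have [A' A'L _] := meet' i (c' (inr i)); have [B BL dB] := meet' j A'.
    exists A', B; rewrite !L'0; split=> //; rewrite /Kbar dB andbT.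
    apply: contraTneq A'L => ->; apply/negP; rewrite inE => h.
    move: BL; rewrite inE => h'; have := Ld i j ij; rewrite -setI_eq0.
    by move=> /eqP/setP/(_ (val B)); rewrite !inE h h' !orbT.
Qed.

(** * Constructions of star bags *)

Lemma leq_card_bigcup {T I : finType} (P : pred I) (F : I -> {set T}) :
  #|\bigcup_(i | P i) F i| <= \sum_(i | P i) #|F i|.
Proof.
elim/big_rec2: _ => [|i m A _ IH]; first by rewrite cards0.
by apply: leq_trans (leq_card_setU _ _) _; rewrite leq_add2l.
Qed.

Lemma card_cover_uniform {T : finType} (P : {set {set T}}) (k : nat) :
  {in P &, forall A B : {set T}, A != B -> [disjoint A & B]} ->
  {in P, forall A : {set T}, #|A| = k} -> #|cover P| = #|P| * k.
Proof.
move=> dP kP; have /eqP <- : trivIset P by apply/trivIsetP => A B; apply: dP.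
by rewrite (eq_bigr (fun=> k)) ?sum_nat_const.
Qed.

(** The first [b] Baranyai classes on the complement of [z] are the leaf sets, and centres come from
    later classes. For each bag at most [q * 'C(n - k.+1, k)] sets miss one of its leaves and
    [q * b] sets are leaves, so at least [b] candidates remain and Hall's condition is immediate. *)
Lemma greedy_bags {n : nat} (k q b : nat) (z : 'I_n) :
  0 < q -> 0 < k -> k * q <= n.-1 -> n - k < k * q ->
  q.+1 * b + q * 'C(n - k.+1, k) <= 'C(n.-1, k) ->
  exists (c : 'I_b -> {set 'I_n}) (L : 'I_b -> {set {set 'I_n}}), bag_family k z c L.
Proof.
move=> q0 k0 kq nk hb.
pose G := ~: [set z].
have cG : #|G| = n.-1 by rewrite cardsC1 card_ord.
have [|f [fd fc]] := @baranyai _ G k q q0; first by rewrite cG.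
rewrite cG in fc.
pose K := [set A : {set 'I_n} | (A \subset G) && (#|A| == k)].
have cK : #|K| = 'C(n.-1, k) by rewrite cards_draws cG.
pose cl (i : nat) := [set A : {set 'I_n} | [&& A \subset G, #|A| == k & f A == i]].
have clP i A : A \in cl i -> [/\ A \subset G, #|A| = k & f A = i].
  by rewrite inE => /and3P[? /eqP ? /eqP ?].
(* The counting hypothesis also ensures that the first [b] classes are full. *)
have ccl i : i < b -> #|cl i| = q.
  move=> ib; rewrite fc; apply/minn_idPl.
  have : q * i.+1 <= q.+1 * b by rewrite leq_mul.
  by rewrite mulnS; lia.
have zG (A : {set 'I_n}) : A \subset G -> z \notin A.
  by move=> AG; apply/negP=> /(subsetP AG); rewrite !inE eqxx.
pose r (i : 'I_b) A := [&& A \in K, b <= f A & [forall B in cl i, ~~ [disjoint A & B]]].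
have [X|c [cI cr]] := @hall _ _ r.
  have [->|/set0Pn[i iX]] := eqVneq X set0; first by rewrite cards0.
  apply: (@leq_trans b); first by rewrite -[leqRHS]card_ord max_card.
  pose bad B := [set A : {set 'I_n} | [disjoint (z |: B) & A] && (#|A| == k)].
  have sub : K \subset nbhd r X :|: (\bigcup_(B in cl i) bad B :|: \bigcup_(j < b) cl j).
    apply/subsetP=> A AK; rewrite !inE; have := AK; rewrite inE => /andP[AG kA].
    have [fA|fA] := ltnP (f A) b.
      apply/or3P/Or33/bigcupP; exists (Ordinal fA) => //.
      by rewrite inE AG kA eqxx.
    case: (boolP [forall B in cl i, ~~ [disjoint A & B]]) => [h|].
      by apply/or3P/Or31/existsP; exists i; rewrite iX /r AK fA.
    rewrite negb_forall => /existsP[B]; rewrite negb_imply negbK => /andP[Bi dAB].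
    apply/or3P/Or32/bigcupP; exists B => //.
    by rewrite inE kA andbT -setI_eq0 setIUl setU_eq0 !setI_eq0 disjoints1 zG // disjoint_sym.
  have h1 : #|\bigcup_(B in cl i) bad B| <= q * 'C(n - k.+1, k).
    apply: leq_trans (leq_card_bigcup _ _) _; rewrite -(ccl i) // -sum_nat_const.
    apply: leq_sum => B /clP[BG kB _]; rewrite card_draws_avoiding cardsU1 zG // kB.
    by rewrite card_ord.
  have h2 : #|\bigcup_(j < b) cl j| <= q * b.
    apply: leq_trans (leq_card_bigcup _ _) _.
    rewrite (eq_bigr (fun=> q)); last by move=> j _; apply: ccl.
    by rewrite sum_nat_const card_ord mulnC.
  have h3 : #|K| <= #|nbhd r X| + (q * 'C(n - k.+1, k) + q * b).
    apply: leq_trans (subset_leq_card sub) _; apply: leq_trans (leq_card_setU _ _) _.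
    rewrite leq_add2l; apply: leq_trans (leq_card_setU _ _) _; exact: leq_add.
  rewrite -(leq_add2r (q * 'C(n - k.+1, k) + q * b)); apply: leq_trans h3.
  by rewrite cK; apply: leq_trans hb; rewrite mulSn -addnA [q * 'C(_, _) + _]addnC.
exists c, (fun i : 'I_b => cl i); split.
- move=> i; have /and3P[] := cr i; rewrite inE => /andP[AG /eqP kA] bf _.
  split=> //; first exact: zG.
  by apply/negP=> /clP[_ _ e]; move: bf; rewrite e leqNgt ltn_ord.
- move=> i A Ai; have [AG kA _] := clP _ _ Ai; split=> //; first exact: zG.
  by have /and3P[_ _ /forall_inP] := cr i; apply.
- move=> i; rewrite (@card_cover_uniform _ _ k).
  + by rewrite ccl // mulnC.
  + move=> A B /clP[AG kA fA] /clP[BG kB fB]; apply: fd => //; by rewrite fA.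
  + by move=> A /clP[].
- move=> i j ij; rewrite -setI_eq0; apply/eqP/setP=> A; rewrite in_setI !in_setU !in_set1 in_set0.
  have cb s : b <= f (c s) by have /and3P[] := cr s.
  apply/negbTE/negP=> /andP[/orP[/eqP E1|A1] /orP[/eqP E2|A2]].
  + by move: ij; rewrite (cI i j) ?eqxx // -E1.
  + by have [_ _ e] := clP _ _ A2; have := cb i; rewrite -E1 e leqNgt ltn_ord.
  + by have [_ _ e] := clP _ _ A1; have := cb j; rewrite -E2 e leqNgt ltn_ord.
  + have [_ _ e1] := clP _ _ A1; have [_ _ e2] := clP _ _ A2.
    by move: ij; rewrite -val_eqE /= -e1 -e2 eqxx.
Qed.

(** The centre is a pair avoiding [z], the leaves are all other pairs that avoid [z] and meet it;
    they cover everything but [z]. *)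
Lemma pair_bag {n : nat} (z : 'I_n) : 3 < n ->
  exists (c : unit -> {set 'I_n}) (L : unit -> {set {set 'I_n}}), bag_family 2 z c L.
Proof.
move=> n3; have : 2 < #|~: [set z]| by rewrite cardsC1 card_ord; lia.
case/card_gt2P=> a [b [w [[]]]]; rewrite !inE => az bz wz [ab bw wa].
pose c := [set a; b].
pose L := [set A : {set 'I_n} | [&& #|A| == 2, z \notin A, A != c & ~~ [disjoint c & A]]].
have pairL x y : x != y -> x != z -> y != z -> x \in c -> y \notin c -> [set x; y] \in L.
  move=> xy xz yz xc yc; rewrite inE cards2 xy !inE !(eq_sym z) negb_or xz yz /=.
  apply/andP; split; first by apply: contraNneq yc => <-; rewrite !inE eqxx orbT.
  by rewrite -setI_eq0; apply/set0Pn; exists x; rewrite in_setI xc !inE eqxx.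
have ac : a \in c by rewrite !inE eqxx.
have bc : b \in c by rewrite !inE eqxx orbT.
have wc : w \notin c by rewrite !inE negb_or wa eq_sym.
exists (fun=> c), (fun=> L); split.
- move=> _; split; first by rewrite cards2 ab.
    by rewrite !inE negb_or !(eq_sym z) az.
  by rewrite inE eqxx !andbF.
- by move=> _ A; rewrite inE => /and4P[/eqP].
- move=> _; have : ~: [set z] \subset cover L.
    apply/subsetP=> x; rewrite !inE => xz.
    have [xc|xc] := boolP (x \in c); apply/bigcupP.
      exists [set x; w]; last by rewrite !inE eqxx.
      by apply: pairL => //; apply: contraNneq wc => <-.
    exists [set a; x]; last by rewrite !inE eqxx orbT.
    by apply: pairL => //; apply: contraNneq xc => <-.
  by move/subset_leq_card; rewrite cardsC1 card_ord; apply: leq_trans; lia.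
- by move=> [] [] /eqP.
Qed.

(* The first h + u Baranyai classes of (k-1)-sets avoiding z, a, b provide
   leaves.  Each class yields two bags: one of its blocks gets a and all others
   get b, or the other way round.  For h of these classes the centre is b (resp.
   a) together with a block, taken from one of the last h classes, that meets the
   exceptional block; for the other u classes it contains both a and b. *)
Lemma swap_bags {n : nat} (k m h u : nat) (z : 'I_n) :
  1 < k -> 1 < m -> m * k.-1 <= n - 3 -> n - 3 < m.+1 * k.-1 ->
  m * (h + u + h) <= 'C(n - 3, k.-1) -> u.*2 <= 'C(n - 3, k - 2) ->
  exists (c : 'I_(h + u) * bool -> {set 'I_n})
    (L : 'I_(h + u) * bool -> {set {set 'I_n}}), bag_family k z c L.
Proof.
move=> k1 m1 mn nm hM hc.
have k10 : 0 < k.-1 by rewrite -subn1 subn_gt0.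
have n3 : 2 < n.
  by apply: leq_trans (_ : 3 <= n - 3 + 2) _; nia.
have : 1 < #|~: [set z]| by rewrite cardsC1 card_ord; lia.
case/card_gt1P=> a [b []]; rewrite !inE => az bz ab.
pose G := ~: (z |: [set a; b]).
have GP x : x \in G = [&& x != z, x != a & x != b] by rewrite !inE !negb_or.
have cG : #|G| = n - 3.
  rewrite -[n in RHS]card_ord -(cardsC (z |: [set a; b])) addnC cardsU1 cards2 ab.
  by rewrite !inE negb_or !(eq_sym z) az bz addnK.
have [||f [fd fc]] := @baranyai _ G k.-1 m; rewrite ?cG 1?mulnC //; first exact: ltnW.
rewrite cG in fc.
pose cl (i : nat) := [set A : {set 'I_n} | [&& A \subset G, #|A| == k.-1 & f A == i]].
have clP i A : A \in cl i -> [/\ A \subset G, #|A| = k.-1 & f A = i].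
  by rewrite inE => /and3P[? /eqP ? /eqP ?].
have ccl i : i < h + u + h -> #|cl i| = m.
  move=> ib; rewrite fc; apply/minn_idPl.
  have : m * i.+1 <= m * (h + u + h) by rewrite leq_mul2l ib orbT.
  by rewrite mulnS; lia.
have cov i : i < h + u + h -> #|cover (cl i)| = m * k.-1.
  move=> ib; rewrite (@card_cover_uniform _ _ k.-1) ?ccl //.
    by move=> A B /clP[AG kA fA] /clP[BG kB fB]; apply: fd => //; rewrite fA.
  by move=> A /clP[].
have covG i : cover (cl i) \subset G by apply/bigcupsP=> A /clP[].
have inG (A : {set 'I_n}) : A \subset G -> [/\ z \notin A, a \notin A & b \notin A].
  by move=> AG; split; apply/negP=> /(subsetP AG); rewrite GP eqxx ?andbF.
pose C0 i := odflt set0 [pick A in cl i].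
have C0P i : i < h + u + h -> C0 i \in cl i.
  move=> ib; rewrite /C0; case: pickP => //= e.
  have := ccl i ib; rewrite (eq_card0 e) => m0; by rewrite -m0 in m1.
(* Class [h + u + i] is reserved to supply a block meeting [C0 i]. One exists, since its [m] blocks
   and a further disjoint (k-1)-set would not fit into [n - 3] points. *)
pose Z i := odflt set0 [pick A in cl (h + u + i) | ~~ [disjoint A & C0 i]].
have ZP i : i < h -> Z i \in cl (h + u + i) /\ ~~ [disjoint Z i & C0 i].
  move=> ih; rewrite /Z; case: pickP => /= [A /andP[]|e] //.
  have jb : h + u + i < h + u + h by rewrite ltn_add2l.
  have ib : i < h + u + h by lia.
  have [CG kC _] := clP _ _ (C0P i ib).
  have : [disjoint cover (cl (h + u + i)) & C0 i].
    rewrite -setI_eq0; apply/eqP/setP=> x; rewrite in_setI in_set0.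
    apply/negbTE/negP=> /andP[/bigcupP[A Ai xA] xC]; have := e A; rewrite Ai /=.
    by move/negbT; rewrite negbK -setI_eq0 => /eqP/setP/(_ x); rewrite in_setI xA xC in_set0.
  move=> d; have : #|cover (cl (h + u + i)) :|: C0 i| <= #|G|.
    by apply: subset_leq_card; rewrite subUset covG.
  rewrite cardsU (eqP (_ : _ :&: _ == set0)) ?setI_eq0 // cards0 subn0 cov // kC cG.
  by rewrite addnC -mulSn => /(leq_trans nm); rewrite ltnn.
pose KK := [set A : {set 'I_n} | (A \subset G) && (#|A| == k - 2)].
have cKK : size (enum KK) = 'C(n - 3, k - 2) by rewrite -cardE cards_draws cG.
(* Centres containing both [a] and [b] need distinct remainders; the (k-2)-sets are numbered and two
   are allotted to each of the [u] classes. *)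
pose idx (i : nat) (sw : bool) := (i - h).*2 + sw.
pose Y i sw := nth set0 (enum KK) (idx i sw).
have idxP i sw : i < h + u -> h <= i -> idx i sw < size (enum KK).
  by move=> iu hi; rewrite cKK; apply: leq_trans hc; rewrite /idx; case: sw; lia.
have YP i sw : i < h + u -> h <= i -> Y i sw \subset G /\ #|Y i sw| = k - 2.
  move=> iu hi; have : Y i sw \in KK by rewrite -mem_enum mem_nth // idxP.
  by rewrite inE => /andP[? /eqP].
pose ab' (s : bool) := if s then a else b.
pose c (p : 'I_(h + u) * bool) :=
  if p.1 < h then ab' p.2 |: Z p.1 else a |: (b |: Y p.1 p.2).
pose leaf i sw C := ab' ((C == C0 i) (+) sw) |: C.
pose L (p : 'I_(h + u) * bool) := [set leaf p.1 p.2 C | C in cl p.1].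
have own1 s (C : {set 'I_n}) : C \subset G ->
    [/\ (ab' s |: C) :&: G = C, (a \in ab' s |: C) = s & b \in ab' s |: C = ~~ s].
  move=> CG; have [zC aC bC] := inG C CG.
  have sG : ab' s \notin G by rewrite GP /ab'; case: s; rewrite eqxx ?andbF.
  split.
  - apply/setP=> x; rewrite !in_setI in_setU1; have [xC|xC] := boolP (x \in C).
      by rewrite orbT (subsetP CG).
    by rewrite orbF; case: eqP => // ->; rewrite (negPf sG).
  - by rewrite in_setU1 (negPf aC) orbF /ab'; case: (s); rewrite ?eqxx ?(negPf ab).
  - by rewrite in_setU1 (negPf bC) orbF /ab'; case: (s); rewrite ?eqxx // eq_sym (negPf ab).
(* The bag of a vertex is read off the vertex, so distinct bags are disjoint. *)
pose own (A : {set 'I_n}) : nat * bool * bool :=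
  if (a \in A) && (b \in A) then
    let s := index (A :\ a :\ b) (enum KK) in (h + s./2, odd s, true)
  else let C := A :&: G in let j := f C in
    if j < h + u then (j, (C == C0 j) (+) (a \in A), false) else (j - (h + u), a \in A, true).
have ownL p A : A \in L p -> own A = (nat_of_ord p.1, p.2, false).
  case/imsetP=> C /clP[CG kC fC] ->; rewrite /own /leaf.
  have [-> -> ->] := own1 ((C == C0 p.1) (+) p.2) C CG.
  by rewrite andbN fC ltn_ord addKb.
have ownc p : own (c p) = (nat_of_ord p.1, p.2, true).
  rewrite /c; case: ltnP => ph.
    have [/clP[ZG _ fZ] _] := ZP p.1 ph; rewrite /own.
    have [-> -> ->] := own1 p.2 _ ZG.
    by rewrite andbN fZ ltnNge leq_addr /= addKn.
  have [YG kY] := YP p.1 p.2 (ltn_ord _) ph; have [zY aY bY] := inG _ YG.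
  rewrite /own !in_setU1 !eqxx orbT /=.
  rewrite setU1K; last by rewrite in_setU1 (negPf ab).
  rewrite setU1K // index_uniq ?idxP ?enum_uniq //.
  rewrite /idx oddD odd_double oddb addFb halfD odd_double doubleK.
  by case: p.2 => /=; congr (_, _, _); lia.
have ownp p A : A \in c p |: L p -> (own A).1 = (nat_of_ord p.1, p.2).
  by rewrite in_setU1 => /orP[/eqP->|/ownL->]; rewrite ?ownc.
have pb (p : 'I_(h + u) * bool) : p.1 < h + u + h by apply: ltn_addr.
exists c, L; split.
- move=> p; split.
  + rewrite /c; case: ltnP => ph.
      have [/clP[ZG kZ fZ] _] := ZP p.1 ph; have [_ aZ bZ] := inG _ ZG.
      rewrite cardsU1 kZ /ab'; case: p.2; rewrite ?aZ ?bZ; lia.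
    have [YG kY] := YP p.1 p.2 (ltn_ord _) ph; have [zY aY bY] := inG _ YG.
    by rewrite !cardsU1 in_setU1 negb_or ab aY bY kY; lia.
  + rewrite /c; case: ltnP => ph.
      have [/clP[ZG kZ fZ] _] := ZP p.1 ph; have [zZ _ _] := inG _ ZG.
      by rewrite in_setU1 negb_or zZ andbT /ab'; case: p.2; rewrite eq_sym.
    have [YG kY] := YP p.1 p.2 (ltn_ord _) ph; have [zY aY bY] := inG _ YG.
    by rewrite !in_setU1 !negb_or zY !(eq_sym z) az bz.
  (* The last component of [own] separates centres from leaves. *)
  + by apply/negP=> /ownL; rewrite ownc.
- move=> p A /imsetP[C Ci ->]; have [CG kC fC] := clP _ _ Ci; have [zC aC bC] := inG C CG.
  rewrite /leaf; set s := (C == C0 p.1) (+) p.2; split.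
  + by rewrite cardsU1 kC /ab'; case: (s); rewrite ?aC ?bC; lia.
  + by rewrite in_setU1 negb_or zC andbT /ab'; case: (s); rewrite eq_sym.
  rewrite -setI_eq0; apply/set0Pn; rewrite /c; case: ltnP => ph; last first.
    by exists (ab' s); rewrite in_setI !in_setU1 eqxx /ab'; case: (s); rewrite eqxx ?orbT.
  have [_] := ZP p.1 ph; rewrite -setI_eq0 => /set0Pn[x]; rewrite in_setI => /andP[xZ xC].
  have [CC|nC] := eqVneq C (C0 p.1); first by exists x; rewrite in_setI !in_setU1 xZ CC xC !orbT.
  by exists (ab' p.2); rewrite /s (negPf nC) addFb in_setI !in_setU1 eqxx.
- move=> p; have leafL C : C \in cl p.1 -> leaf p.1 p.2 C \in L p by apply: imset_f.
  (* As [m > 1], there is a block besides [C0], so both [a] and [b] occur in leaves; the cover then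
     has at least [m * k.-1 + 2 > n - k] elements. *)
  have sub : a |: (b |: cover (cl p.1)) \subset cover (L p).
    have C0in := C0P p.1 (pb p).
    have [C1 C1in nC1] : exists2 C1, C1 \in cl p.1 & C1 != C0 p.1.
      have : 1 < #|cl p.1| by rewrite ccl.
      case/card_gt1P=> C1 [C2 [h1 h2 n12]]; have [E|] := eqVneq C1 (C0 p.1); last by exists C1.
      by exists C2 => //; rewrite -E eq_sym.
    have abin s : ab' s \in cover (L p).
      apply/bigcupP; have [E|E] := eqVneq s p.2.
        exists (leaf p.1 p.2 C1); first exact: leafL.
        by rewrite /leaf (negPf nC1) addFb E in_setU1 eqxx.
      exists (leaf p.1 p.2 (C0 p.1)); first exact: leafL.
      rewrite /leaf eqxx in_setU1 (_ : s = true (+) p.2) ?eqxx //.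
      by move: E; case: (s); case: p.2.
    rewrite !subUset !sub1set (abin true) (abin false) /=.
    apply/bigcupsP=> C Ci; apply: subset_trans (bigcup_sup _ (leafL C Ci)).
    exact: subsetUr.
  move/subset_leq_card: sub; rewrite !cardsU1 in_setU1 negb_or ab cov //.
  have [zc ac bc] := inG _ (covG p.1); rewrite ac bc.
  apply: leq_trans; move: nm; rewrite mulSn; lia.
- move=> p p' ne; rewrite -setI_eq0; apply/eqP/setP=> A; rewrite in_setI in_set0.
  apply/negbTE/negP=> /andP[/ownp e1 /ownp e2]; move: ne; rewrite e1 in e2.
  case: p p' e2 {e1} => [i s] [i' s'] [/= e ->].
  by rewrite (val_inj e) eqxx.
Qed.

(** * Counting the bags *)

(** [b] is the gain over the clique of all k-sets through one element. *)
Definition Kbar_minor (n k b : nat) : Prop :=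
  strongly_1_shallow_Kt_minor (Kbar n k) ('C(n.-1, k.-1) + b).

Lemma Kbar_minor0 (n k : nat) : 0 < k -> 0 < n -> Kbar_minor n k 0.
Proof.
case: n => // n k0 _.
have /(shallow_of_bags k0) : bag_family k (@ord0 n) (fun _ : 'I_0 => set0) (fun=> set0).
  by split=> -[].
by rewrite card_ord.
Qed.

Lemma Kbar_minor_pair (n : nat) : 3 < n -> Kbar_minor n 2 1.
Proof.
case: n => // n n3; have [c [L /(shallow_of_bags (ltn0Sn 1))]] := pair_bag (@ord0 n) n3.
by rewrite card_unit.
Qed.

Lemma Kbar_minor_greedy (n k q b : nat) :
  0 < q -> 0 < k -> k * q < n < k * q.+1 ->
  q.+1 * b + q * 'C(n - k.+1, k) <= 'C(n.-1, k) -> Kbar_minor n k b.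
Proof.
case: n => // n q0 k0 /andP[h1 h2] hb; rewrite mulnS in h2.
have [||c [L /(shallow_of_bags k0)]] := greedy_bags k q b (@ord0 n) q0 k0 _ _ hb; try lia.
by rewrite card_ord.
Qed.

Lemma Kbar_minor_swap (n k m h u : nat) :
  1 < k -> 1 < m -> m * k.-1 <= n - 3 -> n - 3 < m.+1 * k.-1 ->
  m * (h + u + h) <= 'C(n - 3, k.-1) -> u.*2 <= 'C(n - 3, k - 2) ->
  Kbar_minor n k (h + u).*2.
Proof.
case: n => [|n] k1 m1 mn nm hM hc; first by nia.
have [c [L /(shallow_of_bags (ltnW k1))]] := swap_bags k m h u (@ord0 n) k1 m1 mn nm hM hc.
by rewrite card_prod card_ord card_bool muln2.
Qed.

Lemma leq_bin_middle (m j : nat) : 0 < j < m -> m <= 'C(m, j).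
Proof.
elim: m j => // m IH [|j] //= jm; rewrite binS.
have := bin_gt0 m j; rewrite (_ : j <= m) => [h0|]; last by lia.
have [jm'|jm'] := ltnP j.+1 m; first by have := IH j.+1 jm'; lia.
have -> : m = j.+1 by lia.
by rewrite binn binSn.
Qed.

(** Two uses of Pascal's rule give three terms, each at least ['C((j.+1).*2, j)], and
    [3 * j.+1 >= 2 * j.+2]. *)
Lemma bin_central_ge (j : nat) : 2 < j -> j.+1 * 2 ^ j <= 'C((j.+1).*2, j).
Proof.
elim: j => // j IH; rewrite ltnS leq_eqVlt => /orP[/eqP<- //|/IH {}IH].
have E : j.+1 * 'C((j.+1).*2, j.+1) = j.+2 * 'C((j.+1).*2, j).
  by rewrite mul_bin_left; congr (_ * _); lia.
have le1 : 'C((j.+1).*2, j) <= 'C((j.+1).*2, j.+1) by nia.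
have le2 : 'C((j.+1).*2, j) <= 'C((j.+1).*2.+1, j) by apply: leq_bin2l.
rewrite doubleS binS binS expnS; nia.
Qed.

Lemma mul_bin_pred (n k : nat) : 0 < k -> k <= n -> k * 'C(n.-1, k) = (n - k) * 'C(n.-1, k.-1).
Proof. by case: k n => [|k] [|n] //= _ kn; rewrite mul_bin_left subSS. Qed.

Lemma mul_bin_pred2 (n k : nat) : 0 < k -> 0 < n -> k * 'C(n, k) = n * 'C(n.-1, k.-1).
Proof. by case: k n => [|k] [|n] //= _ _; rewrite mul_bin_diag. Qed.

(** With n = 2k + r, this bounds the k-sets avoiding [z] and a given block among those avoiding [z].
    The first three Vandermonde terms are at least 1, k and ['C(k, 2)] times ['C(k + r - 1, k)], and
    1 + 4 + 6 exceeds 8. *)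
Lemma bin_disjoint_le (k r : nat) : 3 < k -> 0 < r <= k.-1 ->
  8 * 'C(k + r - 1, k) <= 'C(2 * k + r - 1, k).
Proof.
move=> k3 /andP[r0 rk]; set a := k + r - 1.
have -> : 2 * k + r - 1 = k + a by lia.
rewrite -binomial.Vandermonde; case: k k3 rk @a => [|[|k]] // k3 rk a.
rewrite !big_ord_recl /= !bin0 bin1; set S := \sum_(i < k) _.
change (8 * 'C(a, k.+2) <= 1 * 'C(a, k.+2) + (k.+2 * 'C(a, k.+1) + ('C(k.+2, 2) * 'C(a, k - 0) + S))).
rewrite subn0.
have E1 : k.+2 * 'C(a, k.+2) = r * 'C(a, k.+1) by rewrite mul_bin_left; congr (_ * _); lia.
have E2 : k.+1 * 'C(a, k.+1) = r.+1 * 'C(a, k) by rewrite mul_bin_left; congr (_ * _); lia.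
have le1 : 'C(a, k.+2) <= 'C(a, k.+1) by nia.
have le2 : 'C(a, k.+2) <= 'C(a, k).
  have : k.+1 * (k.+2 * 'C(a, k.+2)) = r * (r.+1 * 'C(a, k)) by rewrite E1 -E2; lia.
  have : r * r.+1 <= k.+1 * k.+2 by rewrite leq_mul //; lia.
  by nia.
have h6 : 6 <= 'C(k.+2, 2) by rewrite (leq_trans _ (leq_bin2l 2 k3)).
nia.
Qed.

(** Write D = C(n-1, k-1). Here [c] bounds the chromatic number and is about D(2k+r)/(2k), while the
    greedy [b] is at least about D(k+r)/(4k). The surplus is then about D(k-r)/(4k), at least
    D/(4k), and D is at least k 2^(k-1). *)
Lemma minor_quotient2 (k r : nat) : 2 < k -> 0 < r <= k.-1 ->
  exists b c, [/\ Kbar_minor (2 * k + r) k b, 'C(2 * k + r, k) <= 2 * c,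
    c <= 'C((2 * k + r).-1, k.-1) + b &
    3 ^ k.-1 <= 2 ^ k.-1 * (6 * ('C((2 * k + r).-1, k.-1) + b - c) + 11)].
Proof.
move=> k2 /andP[r0 rk].
have greedy b : 3 * b + 2 * 'C(2 * k + r - k.+1, k) <= 'C((2 * k + r).-1, k) ->
    Kbar_minor (2 * k + r) k b.
  by apply: Kbar_minor_greedy => //; lia.
have [k3|k3] := leqP k 3.
  have {k2 k3} ek : k = 3 by lia.
  subst k; have [e|e] : r = 1 \/ r = 2 by lia.
    by exists 6, 18; split; [apply: greedy|..]; rewrite e.
  by exists 9, 28; split; [apply: greedy|..]; rewrite e.
have en : 2 * k + r - k.+1 = k + r - 1 by lia.
have en' : (2 * k + r).-1 = 2 * k + r - 1 by lia.
rewrite en in greedy.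
have k0 : 0 < k by lia.
have cX : 8 * 'C(k + r - 1, k) <= 'C(2 * k + r - 1, k).
  by apply: bin_disjoint_le => //; rewrite r0.
rewrite -{}en' in cX.
have cN : k * 'C((2 * k + r).-1, k) = (k + r) * 'C((2 * k + r).-1, k.-1).
  by rewrite mul_bin_pred //; [congr (_ * _)|]; lia.
have cC : k * 'C(2 * k + r, k) = (2 * k + r) * 'C((2 * k + r).-1, k.-1).
  by rewrite mul_bin_pred2 //; lia.
have cD : k * 2 ^ k.-1 <= 'C((2 * k + r).-1, k.-1).
  have -> : k * 2 ^ k.-1 = k.-1.+1 * 2 ^ k.-1 by rewrite prednK.
  apply: leq_trans (bin_central_ge _ _) _; first by lia.
  by rewrite prednK //; apply: leq_bin2l; lia.
have p8 : 8 <= 2 ^ k.-1 by rewrite (@leq_pexp2l 2 3) //; lia.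
(* The target only asks for 1.5^(k-1), so bounding [3 ^ k.-1] by 4^(k-1) suffices. *)
have p34 : 3 ^ k.-1 <= 2 ^ k.-1 * 2 ^ k.-1 by rewrite -expnMn leq_exp2r //; lia.
move: cX cN cC cD p8 p34 greedy.
move: ('C((2 * k + r).-1, k.-1)) ('C(k + r - 1, k)) ('C((2 * k + r).-1, k)).
move: ('C(2 * k + r, k)) (2 ^ k.-1) (3 ^ k.-1) => C p2 p3 D X N cX cN cC cD p8 p34 greedy.
have [b [b1 b2]] : exists b, 3 * b + 2 * X <= N /\ N <= 3 * b + 2 * X + 2.
  exists ((N - 2 * X) %/ 3); have := divn_eq (N - 2 * X) 3.
  by have := ltn_pmod (N - 2 * X) (isT : 0 < 3); lia.
have [c [c1 c2]] : exists c, C <= 2 * c /\ 2 * c <= C + 1.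
  by exists (uphalf C); have := odd_double_half C; rewrite uphalf_half; case: (odd C); lia.
have key : 12 * (k * c) + 3 * D <= 12 * (k * D) + 12 * (k * b) + 14 * k.
  have h1 : 3 * N <= 12 * b + 8 by lia.
  have h2 : 3 * (k * N) <= 12 * (k * b) + 8 * k by nia.
  have h3 : 2 * (k * c) <= k * C + k by nia.
  have h4 : r * D + D <= k * D by nia.
  by rewrite cN cC in h2 h3; nia.
have ecb : c <= D + b by nia.
exists b, c; split=> //; first exact: greedy.
have [e eE] : exists e, D + b = c + e by exists (D + b - c); lia.
rewrite eE addKn; apply: leq_trans p34 _; rewrite leq_mul2l; apply/orP; right.
have : 12 * (k * e) + 14 * k >= 3 * D.
  have : k * D + k * b = k * c + k * e by rewrite -!mulnDr eE.
  by lia.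
nia.
Qed.

(** Each factor (m-k-i)/(m-i) of the ratio of binomials is at most q/(q+1), because m <= (q+1)k. *)
Lemma ratio_bound (q k m j : nat) : m <= q.+1 * k -> j <= k -> k <= m ->
  q.+1 ^ j * 'C(m - k, j) <= q ^ j * 'C(m, j).
Proof.
move=> mk; elim: j => [|j IH] jk km; first by rewrite !bin0 !expn0.
have {}IH := IH (ltnW jk) km.
rewrite -(leq_pmul2l (ltn0Sn j)) [_ * (_ * 'C(m - k, _))]mulnCA mul_bin_left.
rewrite [_ * (_ * 'C(m, _))]mulnCA mul_bin_left !expnS.
have h : q.+1 * (m - k - j) <= q * (m - j) by nia.
have := leq_mul h IH; rewrite !mulnA; congr (_ <= _); ring.
Qed.

(** The first numerical hypothesis reads q(q/(q+1))^k + (q+1)/q^2 <= 9/10. The summands bound the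
    fractions of k-sets avoiding [z] that miss a block of a given class and that the bags use up;
    the remaining tenth absorbs the rounding of [b]. *)
Lemma greedy_quotient (q k r : nat) : 1 < q -> 0 < k -> 0 < r < k ->
  10 * (q ^ 3 * q ^ k + q.+1 * q.+1 ^ k) <= 9 * (q ^ 2 * q.+1 ^ k) ->
  10 * q.+1 <= 'C((k * q + r).-1, k) ->
  exists b, Kbar_minor (k * q + r) k b /\
    'C(k * q + r, k) <= q * ('C((k * q + r).-1, k.-1) + b).
Proof.
move=> q1 k0 /andP[r0 rk] hq hN; set n := k * q + r.
have nk : k < n by rewrite /n; nia.
have cN : k * 'C(n.-1, k) = (n - k) * 'C(n.-1, k.-1) by rewrite mul_bin_pred //; lia.
have cC : k * 'C(n, k) = n * 'C(n.-1, k.-1) by rewrite mul_bin_pred2 //; lia.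
have cX : q.+1 ^ k * 'C(n - k.+1, k) <= q ^ k * 'C(n.-1, k).
  have -> : n - k.+1 = n.-1 - k by lia.
  by apply: ratio_bound => //; rewrite /n; nia.
have greedy b : q.+1 * b + q * 'C(n - k.+1, k) <= 'C(n.-1, k) -> Kbar_minor n k b.
  by apply: Kbar_minor_greedy; rewrite ?(ltnW q1) // /n; nia.
move: cN cC cX greedy hN; rewrite -/n.
move: 'C(n.-1, k) 'C(n.-1, k.-1) 'C(n, k) 'C(n - k.+1, k) => N D C X cN cC cX greedy hN.
have [b [b1 b2]] : exists b, C <= q * (D + b) /\ q * b <= (C - q * D) + q.
  exists ((C - q * D) %/ q).+1; have := divn_eq (C - q * D) q.
  by have := ltn_pmod (C - q * D) (ltnW q1); rewrite mulnDr mulnS; lia.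
exists b; split=> //; apply: greedy.
have kqb : k * (q * b) <= r * D + k * q.
  have : k * (q * b) <= k * C - k * (q * D) + k * q by rewrite -mulnBr -mulnDr leq_mul2l b2 orbT.
  by rewrite cC /n mulnDl -mulnA; lia.
have nkr : r * q <= n - k.
  have : n - k = k * q.-1 + r by rewrite /n -{1}(prednK (ltnW q1)) mulnS; lia.
  move=> ->; have : r * q.-1 <= k * q.-1 by rewrite leq_mul2r (ltnW rk) orbT.
  by rewrite -{3}(prednK (ltnW q1)) mulnS; lia.
(* Up to rounding, b = rD/(kq) with N = (n-k)D/k, and rq <= n-k. *)
have q2b : q ^ 2 * b <= N + q ^ 2.
  have nk0 : 0 < k * (n - k) by rewrite muln_gt0 k0 subn_gt0.
  rewrite -(leq_pmul2l nk0).
  have : q * (n - k) * (k * (q * b)) <= q * (n - k) * (r * D + k * q) by rewrite leq_mul2l kqb orbT.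
  have -> : q * (n - k) * (k * (q * b)) = k * (n - k) * (q ^ 2 * b) by ring.
  move=> h; apply: leq_trans h _.
  have -> : q * (n - k) * (r * D + k * q) = (r * q) * ((n - k) * D) + k * (n - k) * q ^ 2 by ring.
  rewrite -cN mulnDr leq_add2r.
  have -> : k * (n - k) * N = (n - k) * (k * N) by ring.
  by rewrite leq_mul2r nkr orbT.
have P0 : 0 < 10 * (q ^ 2 * q.+1 ^ k) by rewrite !muln_gt0 !expn_gt0 /= (ltnW q1).
rewrite -(leq_pmul2l P0); move: hq cX P0.
move: (q.+1 ^ k) (q ^ k) => P Q hq cX P0.
have e1 : 10 * (q ^ 2 * P) * (q.+1 * b + q * X)
   = 10 * (q.+1 * P * (q ^ 2 * b)) + 10 * (q ^ 3 * (P * X)) by ring.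
rewrite {}e1.
have h1 : q.+1 * P * (q ^ 2 * b) <= q.+1 * P * (N + q ^ 2) by rewrite leq_mul2l q2b orbT.
have h2 : q ^ 3 * (P * X) <= q ^ 3 * (Q * N) by rewrite leq_mul2l cX orbT.
have h3 : 10 * (q ^ 3 * Q + q.+1 * P) * N <= 9 * (q ^ 2 * P) * N by rewrite leq_mul2r hq orbT.
have h4 : (10 * q.+1) * (q ^ 2 * P) <= N * (q ^ 2 * P) by rewrite leq_mul2r hN orbT.
have h5 : q.+1 * P * (N + q ^ 2) = q.+1 * P * N + q.+1 * (q ^ 2 * P) by ring.
have h6 : (10 * (q ^ 3 * Q + q.+1 * P)) * N = 10 * (q ^ 3 * (Q * N)) + 10 * (q.+1 * P * N) by ring.
have h7 : 10 * (q ^ 2 * P) * N = 9 * (q ^ 2 * P) * N + N * (q ^ 2 * P) by ring.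
have h8 : (10 * q.+1) * (q ^ 2 * P) = 10 * (q.+1 * (q ^ 2 * P)) by ring.
rewrite h7; lia.
Qed.

(** Only (q/(q+1))^k depends on k, and it decreases, so checking k = 24 is enough. The extreme case
    is q = 9, where k = 23 still fails. *)
Lemma greedy_threshold (q k : nat) : 2 < q < 10 -> 24 <= k ->
  10 * (q ^ 3 * q ^ k + q.+1 * q.+1 ^ k) <= 9 * (q ^ 2 * q.+1 ^ k).
Proof.
move=> hq; elim: k => // k IH; rewrite leq_eqVlt => /orP[/eqP<-|/IH {}IH].
  have : q \in iota 3 7 by rewrite mem_iota.
  by rewrite !inE => /or4P[|||/or4P[|||]] /eqP->; lia.
have h : q ^ k <= q.+1 ^ k by apply: leq_exp2r || (by case: (k) => // k'; rewrite leq_exp2r).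
by rewrite !(expnS _ k); nia.
Qed.

(** The gain needed is rD/(kq), with D = C(n-1, k-1). Expressed through c = C(n-3, k-2), it is at
    most 5c/4, as n > 10k; the swap construction gives about 9c/10 + c/2 bags. *)
Lemma swap_quotient (q k r : nat) : 9 < q -> 2 < k -> 0 < r < k ->
  exists b, Kbar_minor (k * q + r) k b /\
    'C(k * q + r, k) <= q * ('C((k * q + r).-1, k.-1) + b).
Proof.
move=> q9 k2 /andP[r0 rk]; set n := k * q + r.
have n10 : 10 * k < n by rewrite /n; nia.
pose m := (n - 3) %/ k.-1.
have k10 : 0 < k.-1 by lia.
have m1 : m * k.-1 <= n - 3 by apply: leq_trunc_div.
have m2 : n - 3 < m.+1 * k.-1 by rewrite -ltn_divLR.
have m3 : 1 < m by rewrite leq_divRL //; lia.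
have cE : k.-1 * 'C(n - 3, k.-1) = (n - k.+1) * 'C(n - 3, k - 2).
  have -> : k.-1 = (k - 2).+1 by lia.
  by rewrite mul_bin_left; congr (_ * _); lia.
have cD : k.-1 * (n - k) * 'C(n.-1, k.-1) = n.-1 * (n - 2) * 'C(n - 3, k - 2).
  have e1 : k.-1 * 'C(n.-1, k.-1) = n.-1 * 'C(n - 2, k - 2).
    rewrite mul_bin_pred2 //; last by lia.
    by congr (_ * 'C(_, _)); lia.
  have e2 : (n - 2) * 'C(n - 3, k - 2) = (n - k) * 'C(n - 2, k - 2).
    have -> : n - 3 = (n - 2).-1 by lia.
    by rewrite mul_bin_down; congr (_ * _); lia.
  by rewrite mulnAC e1 mulnAC -[RHS]mulnA e2; ring.
have cC : k * 'C(n, k) = n * 'C(n.-1, k.-1) by rewrite mul_bin_pred2 //; lia.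
have c28 : 28 <= 'C(n - 3, k - 2).
  by apply: leq_trans (leq_bin_middle _ _ _); lia.
have swap h u : m * (h + u + h) <= 'C(n - 3, k.-1) -> u.*2 <= 'C(n - 3, k - 2) ->
    Kbar_minor n k (h + u).*2.
  by apply: Kbar_minor_swap => //; lia.
clearbody m.
move: cE cD cC c28 swap.
move: 'C(n - 3, k.-1) 'C(n - 3, k - 2) 'C(n.-1, k.-1) 'C(n, k) => E c D C cE cD cC c28 swap.
pose M := E %/ m.
have M1 : m * M <= E by rewrite mulnC leq_trunc_div.
have M2 : E < M.+1 * m by rewrite -ltn_divLR //; lia.
clearbody M.
have M3 : (n - k.+1) * c <= M.+1 * (n - 3).
  rewrite -cE; apply: leq_trans (_ : M.+1 * (m * k.-1) <= _); last by rewrite leq_mul2l m1 orbT.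
  rewrite mulnA [_ * k.-1]mulnC leq_mul2l; apply/orP; right; exact: ltnW.
(* [M] is the number of full classes. *)
have M4 : 9 * c <= 10 * M.+1.
  have n30 : 0 < n - 3 by lia.
  rewrite -(leq_pmul2r n30) -(mulnA 10); apply: leq_trans (_ : 10 * ((n - k.+1) * c) <= _); last first.
    by rewrite leq_mul2l M3 orbT.
  by rewrite mulnA mulnAC leq_mul2r; apply/orP; right; lia.
(* [u] is as large as the supply of (k-2)-sets permits; each of the [h] classes also costs a
   reserved class, so the remaining classes are halved. *)
pose u := c./2; pose h := (M - u)./2.
have u2 : u.*2 <= c /\ c <= u.*2.+1 by have := odd_double_half c; rewrite /u; case: (odd c); lia.
have h2 : h.*2 <= M - u /\ M - u <= h.*2.+1.
  by have := odd_double_half (M - u); rewrite /h; case: (odd _); lia.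
clearbody u h.
have b54 : 5 * c <= 4 * (h + u).*2 by lia.
exists (h + u).*2; split.
  apply: swap; last by case: u2.
  by apply: leq_trans M1; rewrite leq_mul2l; apply/orP; right; lia.
move: b54; move: (h + u).*2 => b b54.
have k0 : 0 < k * (k.-1 * (n - k)) by rewrite !muln_gt0; lia.
rewrite -(leq_pmul2l k0).
have e1 : k * (k.-1 * (n - k)) * C = k * q * (k.-1 * (n - k) * D) + r * (k.-1 * (n - k) * D).
  have -> : k * (k.-1 * (n - k)) * C = k.-1 * (n - k) * (k * C) by ring.
  by rewrite cC {2}/n; ring.
have e2 : k * (k.-1 * (n - k)) * (q * (D + b))
    = k * q * (k.-1 * (n - k) * D) + (k * q) * (k.-1 * (n - k)) * b by ring.
rewrite e1 e2 leq_add2l cD.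
have s1 : r * (n - k).+1 <= k * q * k.-1.
  have a1 : r <= k.-1 by lia.
  have a2 : (n - k).+1 <= k * q by rewrite /n; lia.
  by rewrite mulnC leq_mul.
have s2 : 4 * (n.-1 * (n - 2)) <= 5 * ((n - k) * (n - k).+1).
  have a1 : 9 * n <= 10 * (n - k) by lia.
  have : 81 * (n * n) <= 100 * ((n - k) * (n - k)) by have := leq_mul a1 a1; lia.
  have : n.-1 * (n - 2) <= n * n by rewrite leq_mul; lia.
  rewrite [_ * (n - k).+1]mulnS; move: (_ * (n - 2)) (n * n) ((n - k) * (n - k)).
  by move=> ? ? ?; lia.
have s3 : 4 * (n.-1 * (n - 2) * c) <= 4 * ((n - k) * (n - k).+1 * b).
  have := leq_mul s2 (leqnn c); have := leq_mul (leqnn ((n - k) * (n - k).+1)) b54.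
  lia.
apply: leq_trans (_ : r * ((n - k) * (n - k).+1 * b) <= _).
  rewrite leq_mul2l; apply/orP; right; lia.
have -> : r * ((n - k) * (n - k).+1 * b) = r * (n - k).+1 * ((n - k) * b) by ring.
have -> : k * q * (k.-1 * (n - k)) * b = k * q * k.-1 * ((n - k) * b) by ring.
by rewrite leq_mul2r s1 orbT.
Qed.

(** * Binomial tables for the small quotients *)

Fixpoint pascal_next (p : N) (s : seq N) : seq N :=
  if s is x :: s' then N.add p x :: pascal_next x s' else [::].

(** Binary numbers keep the evaluation feasible; rows are truncated after column [w]. *)
Definition pascal_table (rows w : nat) : seq (seq N) :=
  traject (pascal_next N0) (Npos xH :: nseq w N0) rows.

Lemma pascal_nextE (n j w : nat) :
  pascal_next (N.of_nat 'C(n, j)) [seq N.of_nat 'C(n, i) | i <- iota j.+1 w]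
    = [seq N.of_nat 'C(n.+1, i) | i <- iota j.+1 w].
Proof.
elim: w j => //= w IH j; rewrite IH binS; congr (_ :: _).
by lia.
Qed.

Lemma pascal_tableE (rows w n k : nat) : n < rows -> k <= w ->
  nth N0 (nth [::] (pascal_table rows w) n) k = N.of_nat 'C(n, k).
Proof.
move=> nr kw; rewrite (set_nth_default (Npos xH :: nseq w N0)) ?size_traject //.
rewrite nth_traject //.
have -> : iter n (pascal_next N0) (Npos xH :: nseq w N0)
    = [seq N.of_nat 'C(n, i) | i <- iota 0 w.+1].
  elim: n {nr} => [|n IH] /=.
    congr (_ :: _); suff: forall j, nseq w N0 = [seq N.of_nat 'C(0, i) | i <- iota j.+1 w] by [].
    by elim: w {kw} => //= w IH j; rewrite -IH.
  by rewrite IH /= -(pascal_nextE n 0) !bin0.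
by rewrite (nth_map 0) ?size_iota // nth_iota.
Qed.

(* Tests whether one of the two constructions gives enough bags; binomials are
   read off the table t. *)
Definition quotient_check (t : seq (seq N)) (q k r : nat) : bool :=
  let n := k * q + r in
  let bin m j := nth N0 (nth [::] t m) j in
  let Q := N.of_nat q in
  let C := bin n k in
  let D := bin n.-1 k.-1 in
  let b := N.div (N.add (N.sub C (N.mul Q D)) (N.pred Q)) Q in
  if N.leb (N.add (N.mul (N.succ Q) b) (N.mul Q (bin (n - k.+1) k))) (bin n.-1 k)
     && N.leb C (N.mul Q (N.add D b)) then true
  else
    let m := (n - 3) %/ k.-1 in
    let E := bin (n - 3) k.-1 in
    let c := bin (n - 3) (k - 2) in
    let M := N.div E (N.of_nat m) in
    let u := N.min (N.div2 c) M in
    let h := N.div2 (N.sub M u) in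
    [&& 1 < m, N.leb (N.mul (N.of_nat m) (N.add (N.add h u) h)) E,
        N.leb (N.double u) c & N.leb C (N.mul Q (N.add D (N.double (N.add h u))))].

Lemma quotient_checkP (rows w q k r : nat) : 1 < q -> 2 < k <= w -> 0 < r < k ->
  k * q + r < rows -> quotient_check (pascal_table rows w) q k r ->
  exists b, Kbar_minor (k * q + r) k b /\
    'C(k * q + r, k) <= q * ('C((k * q + r).-1, k.-1) + b).
Proof.
move=> q1 /andP[k2 kw] /andP[r0 rk] nrows; rewrite /quotient_check.
have k1 : k.-1 <= w /\ k - 2 <= w by lia.
have n1 : (k * q + r).-1 < rows /\ k * q + r - k.+1 < rows /\ k * q + r - 3 < rows by lia.
case: k1 n1 => k1 k1' [n1 [n1' n1'']]; rewrite !pascal_tableE //.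
have greedy b : q.+1 * b + q * 'C(k * q + r - k.+1, k) <= 'C((k * q + r).-1, k) ->
    Kbar_minor (k * q + r) k b.
  by apply: Kbar_minor_greedy; [lia | lia | nia].
have swap m h u : 1 < m -> m * k.-1 <= k * q + r - 3 -> k * q + r - 3 < m.+1 * k.-1 ->
    m * (h + u + h) <= 'C(k * q + r - 3, k.-1) -> u.*2 <= 'C(k * q + r - 3, k - 2) ->
    Kbar_minor (k * q + r) k (h + u).*2.
  by apply: Kbar_minor_swap; lia.
move: greedy swap.
have := leq_trunc_div (k * q + r - 3) k.-1.
have : k * q + r - 3 < ((k * q + r - 3) %/ k.-1).+1 * k.-1 by rewrite -ltn_divLR; lia.
move: ((k * q + r - 3) %/ k.-1) => m.
move: 'C(k * q + r, k) 'C((k * q + r).-1, k.-1) 'C((k * q + r).-1, k)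
  'C(k * q + r - k.+1, k) 'C(k * q + r - 3, k.-1) 'C(k * q + r - 3, k - 2).
move=> C D N X E c m1 m2 greedy swap.
(* How [b], [u] and [h] were computed is forgotten: the tested inequalities alone justify the
   bags. *)
set b := N.div _ _; clearbody b; case: ifP => [/andP[/N.leb_le h1 /N.leb_le h2] _|_].
  by exists (N.to_nat b); split; [apply: greedy|]; lia.
set u := N.min _ _; clearbody u; set h := N.div2 _; clearbody h.
move=> /and4P[m3 /N.leb_le h1 /N.leb_le h2 /N.leb_le h3].
exists (N.to_nat h + N.to_nat u).*2; split; last by lia.
by apply: (swap m) => //; lia.
Qed.

(* For 3 <= q <= 9 and k < 24 the estimates of greedy_quotient and swap_quotient
   are too weak, and the binomial inequalities are evaluated one by one. *)
Definition small_quotients_check : bool :=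
  let t := pascal_table 240 24 in
  all (fun q => all (fun k => all (quotient_check t q k) (iota 1 k.-1)) (iota 3 21)) (iota 3 7).

Lemma small_quotients_checked : small_quotients_check.
Proof. by vm_compute. Qed.

Lemma minor_quotient (q k r : nat) : 2 < q -> 2 < k -> 0 < r < k ->
  exists b, Kbar_minor (k * q + r) k b /\
    'C(k * q + r, k) <= q * ('C((k * q + r).-1, k.-1) + b).
Proof.
move=> q2 k2 rk; have [q9|q9] := ltnP 9 q; first exact: swap_quotient.
have [k24|k24] := leqP 24 k.
  apply: greedy_quotient => //; try lia.
    by apply: greedy_threshold => //; rewrite q2.
  apply: leq_trans (leq_bin_middle _ _ _).
    by have := leq_mul k24 (leqnn q); lia.
  by have := leq_mul (leqnn k) q2; lia.
have := small_quotients_checked; rewrite /small_quotients_check.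
move=> /allP/(_ q); rewrite mem_iota => /(_ ltac:(lia)).
move=> /allP/(_ k); rewrite mem_iota => /(_ ltac:(lia)).
move=> /allP/(_ r); rewrite mem_iota => /(_ ltac:(lia)).
apply: quotient_checkP => //; try lia.
(* The largest value of n here is 23 * 9 + 22 = 229, below the 240 rows of the table. *)
by have := leq_mul (ltnW k24) q9; have := leq_mul k24 q9; nia.
Qed.

(** * Assembling the cases *)

Lemma Kbar_minor_le_odd_hadwiger (n k b : nat) :
  Kbar_minor n k b -> 'C(n.-1, k.-1) + b <= odd_hadwiger (Kbar n k).
Proof. by apply: leq_odd_hadwiger; apply: Kbar_sym. Qed.

Lemma minor_of_chi (n k : nat) : 1 < k -> 2 * k <= n ->
  exists b, Kbar_minor n k b /\ chi (Kbar_irr n k) <= 'C(n.-1, k.-1) + b.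
Proof.
move=> k1 kn; pose q := n %/ k; pose r := n %% k.
have k0 := ltnW k1.
have nE : n = k * q + r by rewrite mulnC /q /r -divn_eq.
have rk : r < k by rewrite ltn_pmod.
have q1 : 1 < q by rewrite leq_divRL.
clearbody q r; rewrite nE.
suff [b [hb bC]] : exists b, Kbar_minor (k * q + r) k b /\
    'C(k * q + r, k) <= q * ('C((k * q + r).-1, k.-1) + b).
  by exists b; split=> //; apply: (@chi_Kbar_le _ _ q) => //; [exact: ltnW | exact: leq_addr].
have n0 : 0 < k * q + r by rewrite addn_gt0 muln_gt0 k0 ltnW.
have cC := mul_bin_pred2 (k * q + r) k k0 n0.
(* If k divides n, then C(n, k) = q C(n-1, k-1) and the clique alone suffices. *)
have [r0|r0] := posnP r.
  exists 0; split; first exact: Kbar_minor0.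
  by rewrite addn0 -(leq_pmul2l k0) cC r0 addn0 mulnA.
have [k2|k2] := leqP k 2.
  have ek : k = 2 by lia.
  (* For k = 2 and n = 2q + 1, C(n, 2) = qn, so one bag beyond the clique of size n - 1 is exactly
     enough. *)
  subst k; exists 1; split; first by apply: Kbar_minor_pair; lia.
  by move: cC; rewrite (_ : r = 1) ?bin1 //; [nia | lia].
have [q2|q2] := leqP q 2; last by apply: minor_quotient => //; rewrite r0.
have -> : q = 2 by lia.
rewrite [k * 2]mulnC; have [|b [c [hb Cc cb _]]] := minor_quotient2 k r k2.
  by lia.
by exists b; split=> //; apply: leq_trans Cc _; rewrite leq_mul2l cb.
Qed.

(** Both ranges of the final claim have quotient 2 and nonzero remainder, so one estimate, cleared
    of denominators, serves them together. *)
Lemma odd_hadwiger_gap (n k : nat) : 2 < k -> 2 * k + 1 <= n <= 3 * k - 1 ->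
  exists e, chi (Kbar_irr n k) + e <= odd_hadwiger (Kbar n k) /\
    3 ^ (k - 1) <= 2 ^ (k - 1) * (6 * e + 11).
Proof.
move=> k2 /andP[n1 n2]; have nE : n = 2 * k + (n - 2 * k) by lia.
move: (n - 2 * k) nE => r nE; subst n.
have [|b [c [hb Cc cb e3]]] := minor_quotient2 k r k2; first by lia.
rewrite subn1; eexists; split; last exact: e3.
have := Kbar_minor_le_odd_hadwiger _ _ _ hb.
have : chi (Kbar_irr (2 * k + r) k) <= c by apply: (@chi_Kbar_le _ _ 2) => //; lia.
by lia.
Qed.

Theorem theorem1p1 (n k : nat) (Hk : 2 <= k) (Hn : 2 * k <= n) :
  chi (Kbar_irr n k) <= odd_hadwiger (Kbar n k) /\
  (exists t : nat, chi (Kbar_irr n k) <= t /\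
                   strongly_1_shallow_Kt_minor (Kbar n k) t) /\
  (3 <= k ->
    (2 * k + 1 <= n <= 3 * k - 2 ->
       (12%:R^-1 * ((3%:R / 2%:R) ^+ (k - 1) - 8%:R * k%:R - 2%:R)
         <= (odd_hadwiger (Kbar n k))%:R - (chi (Kbar_irr n k))%:R :> rat)%R) /\
    (n = 3 * k - 1 ->
       (6%:R^-1 * ((3%:R / 2%:R) ^+ (k - 1) - 11%:R)
         <= (odd_hadwiger (Kbar n k))%:R - (chi (Kbar_irr n k))%:R :> rat)%R)).
Proof.
have [b [hb chib]] := minor_of_chi _ _ Hk Hn.
split; first exact: leq_trans chib (Kbar_minor_le_odd_hadwiger _ _ _ hb).
split; first by exists ('C(n.-1, k.-1) + b).
move=> k3.
have gap : 2 * k + 1 <= n <= 3 * k - 1 -> exists e : nat,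
    ((chi (Kbar_irr n k))%:R + e%:R <= (odd_hadwiger (Kbar n k))%:R :> rat)%R /\
    ((3%:R / 2%:R) ^+ (k - 1) <= 6%:R * e%:R + 11%:R :> rat)%R.
  case/(odd_hadwiger_gap _ _ k3)=> e [he h3]; exists e.
  rewrite -natrD ler_nat he; split=> //.
  rewrite expr_div_n ler_pdivrMr ?exprn_gt0 // mulrC.
  by rewrite -!natrX -natrM -natrD -natrM ler_nat.
have k3' : (3%:R <= k%:R :> rat)%R by rewrite ler_nat.
split=> hn.
  (* Since 8k + 2 >= 26 > 11, the bound claimed here is at most e/2. *)
  have [|e [he h3]] := gap; first by lia.
  have e0 : (0 <= e%:R :> rat)%R by apply: ler0n.
  by lra.
have [|e [he h3]] := gap; first by lia.
by lra.
Qed.
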